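(* Let $X$ be a separable infinite-dimensional Fréchet space (over $\mathbb{K}=\mathbb{R}$ or $\mathbb{C}$). Then there exists a continuous linear operator $T:X\to X$ which is mixing and which possesses a hypercyclic subspace.
   Context: A continuous linear operator $T:X\to X$ is mixing if for all non-empty open sets $U,V\subset X$ there exists $N$ such that $T^n(U)\cap V\neq\emptyset$ for every $n\ge N$. A vector $x\in X$ is hypercyclic for $T$ if its orbit $\{T^n x\}_n$ is dense in $X$. A hypercyclic subspace for $T$ is a closed infinite-dimensional subspace of $X$ in which every non-zero vector is hypercyclic for $T$. *)

(* Defs.v *)
From HB Require Import structures.
From mathcomp Require Import all_boot all_order all_algebra.
From mathcomp Require Import complex.
From mathcomp Require Import boolp classical_sets functions cardinality.
From mathcomp Require Import reals topology normedtype.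

Set Implicit Arguments.
Unset Strict Implicit.
Unset Printing Implicit Defensive.

Import Order.TTheory GRing.Theory Num.Theory.
Import numFieldTopology.Exports.

Local Open Scope classical_set_scope.
Local Open Scope ring_scope.
Local Open Scope complex_scope.

(* Seminorms take values in K, like the norms of the library; when K is the
   field of complex numbers, 0 <= p x says that p x is a nonnegative real. *)
Definition is_seminorm (K : numFieldType) (X : lmodType K) (p : X -> K) :=
  [/\ forall x, 0 <= p x,
      forall x y, p (x + y) <= p x + p y
    & forall (a : K) x, p (a *: x) = `|a| * p x].

(* Completeness for the translation-invariant uniformity of X; the library
   does not force the uniform structure of a tvsType to be that one, so its
   completeness would be a different notion. Sequences suffice because the
   notion is only used for metrizable spaces. *)
Definition complete_tvs (K : numFieldType) (X : topologicalLmodType K) :=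
  forall u : nat -> X,
    (forall U : set X, nbhs 0 U ->
       exists N : nat, forall m n : nat,
         (N <= m)%N -> (N <= n)%N -> U (u m - u n)) ->
    exists l : X, u @ \oo --> l.

Definition is_frechet (K : numFieldType) (X : topologicalLmodType K) :=
  (exists p : nat -> X -> K,
     [/\ forall n, is_seminorm (p n),
         forall n x, p n x <= p n.+1 x,
         forall x, (forall n, p n x = 0) -> x = 0
       & forall U : set X, nbhs 0 U <->
           exists n (e : K), 0 < e /\ [set x | p n x < e] `<=` U])
  /\ complete_tvs X.

Definition separable (X : topologicalType) :=
  exists D : set X, countable D /\ dense D.

Definition finite_dimensional (K : numFieldType) (X : lmodType K) (M : set X) :=
  exists n (e : 'I_n -> X),
    (forall i, M (e i)) /\
    forall x, M x -> exists c : 'I_n -> K, x = \sum_(i < n) c i *: e i.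

Definition mixing (X : topologicalType) (T : X -> X) :=
  forall U V : set X, open U -> U !=set0 -> open V -> V !=set0 ->
    exists N : nat, forall n, (N <= n)%N -> (iter n T @` U) `&` V !=set0.

Definition hypercyclic (X : topologicalType) (T : X -> X) (x : X) :=
  dense (range (fun n => iter n T x)).

Definition hypercyclic_subspace (K : numFieldType) (X : topologicalLmodType K)
    (T : X -> X) (M : set X) :=
  [/\ closed M,
      submod_closed (fun x => x \in M),
      ~ finite_dimensional M
    & forall x, M x -> x != 0 -> hypercyclic T x].

(* K is the field of real numbers or the field of complex numbers. *)
Definition real_or_complex (R : realType) (K : numFieldType) :=
  K = R \/ K = R[i].

(* Main.v *)
Require Import Defs.
From HB Require Import structures.
From mathcomp Require Import all_boot all_order all_algebra.
From mathcomp Require Import complex.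
From mathcomp Require Import boolp classical_sets functions cardinality.
From mathcomp Require Import reals topology normedtype.
From mathcomp Require Import ring zify.

Set Implicit Arguments.
Unset Strict Implicit.
Unset Printing Implicit Defensive.

Import Order.TTheory GRing.Theory Num.Theory.
Import numFieldTopology.Exports.

Local Open Scope classical_set_scope.
Local Open Scope ring_scope.

(** Let [p 0 <= p 1 <= ...] be seminorms defining the topology of [X]. Two cases are
    distinguished.

    First case: for some [a], no finite set of continuous functionals has its joint
    kernel inside the kernel of [p a] (this is so when the quotient of [X] by the
    kernel of [p a] is infinite-dimensional). The Hahn-Banach theorem then yields a
    biorthogonal system [(x_n, f_n)] with dense span in which all [f_n] are bounded by
    the single seminorm [p a] ([adapted_system]). After scaling, the operator
    [S v = \sum_n f_(2n+1)(v) x_n] converges, and [T = 1 + S]. The indices fall into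
    infinitely many chains [2m, 4m + 1, 8m + 3, ...] along which [S] is a backward
    shift. On the span of a chain, Newton interpolation identifies [T] with the
    translation by 1 of polynomials, so that [T^n] is the translation by [n]. Since
    [X^i (1 - X/n)^(i+1)] is close to [X^i] while its translate by [n] is close to 0,
    and symmetrically for the translation by [-n], the orbit of a vector of the span
    can be steered, after an arbitrarily small perturbation and at every late time, to
    any vector of the span ([steer_span]). This gives mixing.

    The hypercyclic subspace comes from the fixed vectors of [T]. The chains start at
    the [x_(2k)], and the system is built so that the functionals [f_(2k)] separate
    the points of a closed infinite-dimensional subspace [M_0] of the kernel of [S].
    By steering infinitely many vectors at once, one finds small vectors [zeta_k] such
    that, for every [k0] and [y], at suitable times [T^n zeta_(k0)] is close to [y]
    while all other [T^n zeta_k] are close to 0 ([universal_vectors]). Put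
    [Z v = \sum_k f_(2k)(v) zeta_k]. For [v] in [M_0], [T^n (v + Z v) = v + T^n Z v],
    and as soon as some [f_(2k)(v)] is nonzero this comes close to every vector. The
    steering never changes the coordinates [f_(2k)], so these vanish on the range of
    [Z]; hence [Z^2 = 0], [1 + Z] is an isomorphism and the image of [M_0] under it is
    closed ([graph_subspace]).

    Second case: each seminorm vanishes on the joint kernel of finitely many
    continuous functionals. Then [X] is the space of all scalar sequences, in suitable
    coordinates ([coordinate_system], [prescribed_coordinates]), and [T] is the
    backward shift. Mixing is obvious. Cut the index set into finite blocks and share
    them out among infinitely many owners, so that the blocks of each owner spell long
    initial parts of all vectors of a dense sequence. The sequences that are, on the
    blocks of each owner, a multiple of what is spelled there form the hypercyclic
    subspace ([template_subspace]). *)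

(** * Choosing sequences one term at a time *)

(** Dependent choice where a term may depend on all earlier ones: the next term need only
    exist after a finite sequence that was itself chosen according to the rule. *)
Lemma sequential_choice (A : Type) (a0 : A) (P : seq A -> A -> Prop) :
  (forall s, (forall i, (i < size s)%N -> P (take i s) (nth a0 s i)) ->
     exists a, P s a) ->
  exists u : nat -> A, forall n, P (mkseq u n) (u n).
Proof.
move=> stepP.
pose good s := forall i, (i < size s)%N -> P (take i s) (nth a0 s i).
have /choice[F FP] (s : seq A) : exists a, good s -> P s a.
  have [/stepP[a Pa]|ngood] := pselect (good s); first by exists a.
  by exists a0.
pose L n := iter n (fun s => rcons s (F s)) [::].
exists (fun n => F (L n)).
have LE n : L n = mkseq (fun n => F (L n)) n.
  by elim: n => [//|n IHn]; rewrite {1}/L iterS -/(L n) {1}IHn mkseqS -IHn.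
suff goodL n : good (L n) by move=> n; rewrite -LE; exact: FP.
elim: n => [|n IHn] i //.
have szL : size (L n) = n by rewrite LE size_mkseq.
rewrite [L n.+1]iterS -/(L n) size_rcons szL ltnS leq_eqVlt => /predU1P[->|ltin].
  rewrite -cats1 take_cat nth_cat szL ltnn subnn take0 cats0 /=.
  exact: FP.
by rewrite -cats1 take_cat nth_cat szL ltin; apply: IHn; rewrite szL.
Qed.

Lemma eventually_all (P : nat -> nat -> Prop) l :
  (forall k, exists N : nat, forall n, (N <= n)%N -> P k n) ->
  exists N : nat, forall n k, (N <= n)%N -> (k <= l)%N -> P k n.
Proof.
move=> /choice[N HN]; exists (\max_(k < l.+1) N k) => n k leNn lekl; apply: HN.
by apply: leq_trans leNn; rewrite -ltnS in lekl; apply: (leq_bigmax (Ordinal lekl)).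
Qed.

(** The 2-adic valuation takes each value at arbitrarily large numbers. *)
Lemma recurrent_enumeration (T : countType) (t0 : T) :
  exists e : nat -> T, forall t N, exists2 l, (N <= l)%N & e l = t.
Proof.
exists (fun l => odflt t0 (unpickle (logn 2 l.+1))) => t N.
have gt0 : (0 < 2 ^ pickle t * N.*2.+1)%N by rewrite muln_gt0 expn_gt0.
exists (2 ^ pickle t * N.*2.+1).-1.
  rewrite -ltnS prednK // (@leq_trans N.*2.+1) //; first by rewrite ltnS -addnn leq_addr.
  by rewrite leq_pmull // expn_gt0.
rewrite prednK // lognM ?expn_gt0 // pfactorK // [logn 2 N.*2.+1]logn_coprime ?addn0 ?pickleK //.
by rewrite coprime2n /= odd_double.
Qed.

(** * Linear maps and biorthogonal systems *)

Section Packing.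
Variables (K : numFieldType) (X : lmodType K).

Definition pack_form (f : X -> K) (lin_f : scalar f) : {scalar X} :=
  HB.pack f (GRing.isLinear.Build K X K *%R f lin_f).

Definition pack_operator (T : X -> X) (lin_T : linear T) : {linear X -> X} :=
  HB.pack T (GRing.isLinear.Build K X X *:%R T lin_T).

Lemma finite_rank_is_linear (f : nat -> {scalar X}) (y : nat -> X) N :
  linear (fun x => \sum_(i < N) f i x *: y i).
Proof.
move=> a u v; rewrite scaler_sumr -big_split; apply: eq_bigr => i _ /=.
by rewrite linearP scalerDl scalerA.
Qed.

Definition finite_rank f y N := pack_operator (finite_rank_is_linear f y N).

Lemma id_sub_is_linear (L : {linear X -> X}) : linear (fun x => x - L x).
Proof. by move=> a u v; rewrite linearP scalerBr opprD addrACA. Qed.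

Definition id_sub L := pack_operator (id_sub_is_linear L).

(** For a biorthogonal system this is the projection onto the joint kernel of the first [n]
    functionals. Composing a functional with it makes the functional vanish at the first
    [n] vectors. *)
Definition residual (f : nat -> {scalar X}) (x : nat -> X) n :=
  id_sub (finite_rank f x n).

Lemma residual_fixed (f : nat -> {scalar X}) (x : nat -> X) n v :
  (forall i, (i < n)%N -> f i v = 0) -> residual f x n v = v.
Proof. by move=> fv; rewrite /= big1 ?subr0 // => i _; rewrite fv ?scale0r. Qed.

Section Biorthogonal.
Variables (f : nat -> {scalar X}) (x : nat -> X) (n : nat).
Hypothesis f_x : forall i j, (i < n)%N -> (j < n)%N -> f i (x j) = (i == j)%:R.

Lemma form_combination (c : nat -> K) i : (i < n)%N ->
  f i (\sum_(j < n) c j *: x j) = c i.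
Proof.
move=> lti; rewrite linear_sum (bigD1 (Ordinal lti)) //= linearZ /= f_x // eqxx mulr1.
rewrite big1 ?addr0 // => j; rewrite -(inj_eq val_inj) eq_sym /= => /negPf nij.
by rewrite linearZ /= f_x // nij mulr0.
Qed.

Lemma residual_null i v : (i < n)%N -> f i (residual f x n v) = 0.
Proof. by move=> lti; rewrite /= linearB (form_combination (fun j => f j v)) ?subrr. Qed.

Lemma residual_root j : (j < n)%N -> residual f x n (x j) = 0.
Proof.
move=> ltj; rewrite /= (bigD1 (Ordinal ltj)) //= f_x // eqxx scale1r.
rewrite big1 ?addr0 ?subrr // => i; rewrite -(inj_eq val_inj) /= => /negPf nij.
by rewrite f_x // nij scale0r.
Qed.
End Biorthogonal.

(** The pair [(v, g)] may be appended to the first [n] pairs of a biorthogonal system. *)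
Definition dual_extension (x : nat -> X) (f : nat -> {scalar X}) n (v : X) (g : {scalar X}) :=
  [/\ g v = 1, forall i, (i < n)%N -> g (x i) = 0 & forall i, (i < n)%N -> f i v = 0].

Lemma dual_extension_biorthogonal (x : nat -> X) (f : nat -> {scalar X}) n :
  (forall i, (i < n)%N -> dual_extension x f i (x i) (f i)) ->
  forall i j, (i < n)%N -> (j < n)%N -> f i (x j) = (i == j)%:R.
Proof.
move=> dual i j lti ltj; case: (ltngtP i j) => [ltij|ltji|<-].
- by have [_ _ E] := dual _ ltj; rewrite E.
- by have [_ E _] := dual _ lti; rewrite E.
- by have [E _ _] := dual _ lti; rewrite E.
Qed.

Lemma dual_extension_ext (x x' : nat -> X) (f f' : nat -> {scalar X}) n v g :
  (forall i, (i < n)%N -> x i = x' i) -> (forall i, (i < n)%N -> f i = f' i) ->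
  dual_extension x f n v g -> dual_extension x' f' n v g.
Proof.
move=> xx' ff' [gv gx fv]; split=> // i lti; first by rewrite -xx' ?gx.
by rewrite -ff' ?fv.
Qed.

Lemma scale_form_is_scalar (a : K) (f : {scalar X}) : scalar (fun x => a * f x).
Proof. by move=> c u v; rewrite linearP mulrDr mulrCA. Qed.

Definition scale_form a f := pack_form (scale_form_is_scalar a f).

Lemma scale_formE a f x : scale_form a f x = a * f x. Proof. by []. Qed.

Lemma iter_linear (T : {linear X -> X}) n : linear (iter n T).
Proof. by elim: n => [//|n IHn] a x y; rewrite !iterS IHn linearP. Qed.

Lemma iter_linear0 (T : {linear X -> X}) n : iter n T 0 = 0.
Proof. by elim: n => [//|n IHn]; rewrite iterS IHn linear0. Qed.

End Packing.

(** * Small scalars *)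

Definition archimedean (K : numFieldType) :=
  forall x : K, 0 <= x -> exists n : nat, x < n%:R.

Section Small.
Variable K : numFieldType.
Hypothesis archK : archimedean K.

Lemma harmonic_small (C e : K) : 0 <= C -> 0 < e ->
  exists N : nat, forall n, (N <= n)%N -> C * n.+1%:R^-1 < e.
Proof.
move=> C0 e0; have [N CN] := archK (divr_ge0 C0 (ltW e0)).
exists N => n leNn; rewrite ltr_pdivrMr ?ltr0Sn // mulrC -ltr_pdivrMr //.
by apply: lt_le_trans CN _; rewrite ler_nat ltnW.
Qed.

Lemma geometric_small (C e : K) : 0 <= C -> 0 < e ->
  exists N : nat, forall n, (N <= n)%N -> C * 2^-1 ^+ n < e.
Proof.
move=> C0 e0; have [N CN] := harmonic_small C0 e0.
exists N => n /CN; apply: le_lt_trans; apply: ler_wpM2l => //.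
rewrite exprVn lef_pV2 ?posrE ?ltr0Sn ?exprn_gt0 //.
by rewrite -natrX ler_nat ltn_expl.
Qed.

Lemma geom_ge0 n : 0 <= 2^-1 ^+ n :> K.
Proof. by rewrite exprn_ge0 // invr_ge0. Qed.

Lemma geom_gt0 n : 0 < 2^-1 ^+ n :> K.
Proof. by rewrite exprn_gt0 // invr_gt0. Qed.

Lemma geom_half n : 2^-1 ^+ n = 2^-1 ^+ n.+1 + 2^-1 ^+ n.+1 :> K.
Proof. by rewrite exprS; field. Qed.

Lemma geom_le m n : (m <= n)%N -> 2^-1 ^+ n <= 2^-1 ^+ m :> K.
Proof.
move=> lemn; apply: ler_wiXn2l => //; first by rewrite invr_ge0.
by rewrite invf_le1 // ler1n.
Qed.

Lemma sum_geom_le n : \sum_(i < n) 2^-1 ^+ i <= 2 :> K.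
Proof.
suff -> : \sum_(i < n) 2^-1 ^+ i = 2 - 2 * 2^-1 ^+ n :> K.
  by rewrite lerBlDr lerDl mulr_ge0 // geom_ge0.
elim: n => [|n IHn]; first by rewrite big_ord0 expr0; ring.
by rewrite big_ord_recr /= IHn (geom_half n); field.
Qed.

End Small.

(** * Graded families of seminorms *)

Section Seminorm.
Variables (K : numFieldType) (X : lmodType K) (r : X -> K).
Hypothesis sn_r : is_seminorm r.

Lemma sn_ge0 x : 0 <= r x. Proof. by case: sn_r. Qed.
Lemma snD x y : r (x + y) <= r x + r y. Proof. by case: sn_r. Qed.
Lemma snZ a x : r (a *: x) = `|a| * r x. Proof. by case: sn_r. Qed.
Lemma sn0 : r 0 = 0. Proof. by rewrite -(scale0r 0) snZ normr0 mul0r. Qed.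
Lemma snN x : r (- x) = r x.
Proof. by rewrite -scaleN1r snZ normrN1 mul1r. Qed.
Lemma snBC x y : r (x - y) = r (y - x). Proof. by rewrite -opprB snN. Qed.
Lemma snB x y : r (x - y) <= r x + r y.
Proof. by rewrite -(snN y) snD. Qed.
Lemma sn_tri y x z : r (x - z) <= r (x - y) + r (y - z).
Proof. by apply: le_trans (snD _ _); rewrite addrA subrK. Qed.
Lemma sn_gt0 x : (0 < r x) = (r x != 0).
Proof. by rewrite lt_def sn_ge0 andbT. Qed.
Lemma sn_sum I (s : seq I) (F : I -> X) :
  r (\sum_(i <- s) F i) <= \sum_(i <- s) r (F i).
Proof.
elim: s => [|i s IHs]; first by rewrite !big_nil sn0.
by rewrite !big_cons (le_trans (snD _ _)) // lerD2l.
Qed.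
End Seminorm.

Definition graded_seminorms (K : numFieldType) (X : lmodType K)
    (p : nat -> X -> K) :=
  [/\ forall n, is_seminorm (p n),
      forall n x, p n x <= p n.+1 x
    & forall x, (forall n, p n x = 0) -> x = 0].

Section Graded.
Variables (K : numFieldType) (X : lmodType K) (p : nat -> X -> K).

Definition tends (u : nat -> X) (l : X) :=
  forall m (e : K), 0 < e ->
    exists N : nat, forall n, (N <= n)%N -> p m (u n - l) < e.

Definition seq_complete :=
  forall u : nat -> X,
    (forall m (e : K), 0 < e -> exists N : nat, forall i j : nat,
       (N <= i)%N -> (N <= j)%N -> p m (u i - u j) < e) ->
    exists l, tends u l.

Definition bounded_form (f : X -> K) :=
  exists m (C : K), 0 <= C /\ forall x, `|f x| <= C * p m x.

Definition bounded_operator (T : X -> X) :=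
  forall m, exists m' (C : K), 0 <= C /\ forall x, p m (T x) <= C * p m' x.

Definition approximable (D : X -> Prop) :=
  forall x m (e : K), 0 < e -> exists2 y, D y & p m (y - x) < e.

(** Density along every tail of the sequence, so that a tolerance that shrinks with the
    index may be imposed on the approximation. *)
Definition approximating (d : nat -> X) :=
  forall x m (e : K) N, 0 < e -> exists2 l, (N <= l)%N & p m (d l - x) < e.

(** The conclusion with closedness, density and mixing read off the seminorms, and
    infinite dimension witnessed by a biorthogonal sequence. *)
Definition mixing_with_hypercyclic_subspace :=
  exists T : {linear X -> X},
  [/\ bounded_operator T,
      forall u v m (e : K), 0 < e -> exists N : nat, forall n, (N <= n)%N ->
        exists w, p m (w - u) < e /\ p m (iter n T w - v) < e
    & exists M : X -> Prop,
      [/\ forall x, (forall m (e : K), 0 < e ->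
                       exists2 y, M y & p m (y - x) < e) -> M x,
          M 0 /\ forall a x y, M x -> M y -> M (a *: x + y),
          exists (b : nat -> X) (f : nat -> {scalar X}),
            (forall i, M (b i)) /\ forall i j, f i (b j) = (i == j)%:R
        & forall x, M x -> x != 0 -> approximable (fun y => exists n, y = iter n T x)]].

Hypothesis archK : archimedean K.
Hypothesis gp : graded_seminorms p.

Lemma gsn m : is_seminorm (p m). Proof. by case: gp. Qed.

Lemma gsn_mono m n x : (m <= n)%N -> p m x <= p n x.
Proof.
case: gp => _ pS _; elim: n => [|n IHn]; first by rewrite leqn0 => /eqP->.
rewrite leq_eqVlt => /predU1P[->//|/IHn le_mn].
exact: le_trans le_mn (pS _ _).
Qed.

Lemma gsn_eq0 x : (forall m (e : K), 0 < e -> p m x < e) -> x = 0.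
Proof.
case: gp => _ _ sep px; apply: sep => m; apply/eqP.
have := sn_gt0 (gsn m) x; case: eqP => //= _ gt0.
by have := px m _ gt0; rewrite ltxx.
Qed.

Lemma tends_unique u l l' : tends u l -> tends u l' -> l = l'.
Proof.
move=> ul ul'; apply/eqP; rewrite -subr_eq0; apply/eqP; apply: gsn_eq0 => m e e0.
have e2 : 0 < e / 2 by rewrite divr_gt0.
have [N HN] := ul m _ e2; have [N' HN'] := ul' m _ e2.
apply: le_lt_trans (sn_tri (gsn m) (u (maxn N N')) _ _) _.
rewrite (snBC (gsn m) l) [e](_ : _ = e / 2 + e / 2); last by field.
by rewrite ltrD // ?HN ?HN' // ?leq_maxl ?leq_maxr.
Qed.

Lemma tendsD u l u' l' : tends u l -> tends u' l' ->
  tends (fun n => u n + u' n) (l + l').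
Proof.
move=> ul ul' m e e0; have e2 : 0 < e / 2 by rewrite divr_gt0.
have [N HN] := ul m _ e2; have [N' HN'] := ul' m _ e2.
exists (maxn N N') => n; rewrite geq_max => /andP[/HN lt1 /HN' lt2].
rewrite opprD addrACA; apply: le_lt_trans (snD (gsn m) _ _) _.
by rewrite [e](_ : _ = e / 2 + e / 2); [rewrite ltrD | field].
Qed.

Lemma tendsZ a u l : tends u l -> tends (fun n => a *: u n) (a *: l).
Proof.
move=> ul m e e0; have a1 : 0 < `|a| + 1 by rewrite ltr_wpDl.
have [N HN] := ul m _ (divr_gt0 e0 a1); exists N => n /HN.
rewrite ltr_pdivlMr // -scalerBr (snZ (gsn m)); apply: le_lt_trans.
by rewrite mulrC ler_wpM2l ?(sn_ge0 (gsn m)) // lerDl.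
Qed.

Lemma tends_cst l : tends (fun=> l) l.
Proof. by move=> m e e0; exists 0 => n _; rewrite subrr (sn0 (gsn m)). Qed.

Lemma tends_eq_from u u' l N : (forall n, (N <= n)%N -> u n = u' n) ->
  tends u l -> tends u' l.
Proof.
move=> uu' ul m e /(ul m)[N' HN']; exists (maxn N N') => n.
by rewrite geq_max => /andP[/uu' <- /HN'].
Qed.

Lemma tends_operator (T : {linear X -> X}) u l :
  bounded_operator T -> tends u l -> tends (T \o u) (T l).
Proof.
move=> bT ul m e e0; have [m' [C [C0 bm]]] := bT m.
have C1 : 0 < C + 1 by rewrite ltr_wpDl.
have [N HN] := ul m' _ (divr_gt0 e0 C1); exists N => n /HN.
rewrite ltr_pdivlMr //= -linearB; apply: le_lt_trans.
by apply: le_trans (bm _) _; rewrite mulrC ler_wpM2l ?(sn_ge0 (gsn _)) // lerDl.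
Qed.

Lemma tends_form (f : {scalar X}) u l (c : K) N : bounded_form f -> tends u l ->
  (forall n, (N <= n)%N -> f (u n) = c) -> f l = c.
Proof.
move=> [m [C [C0 bf]]] ul fu; apply/eqP; rewrite -subr_eq0; apply: contraT.
rewrite -normr_gt0 => e0; have C1 : 0 < C + 1 by rewrite ltr_wpDl.
have [N' HN'] := ul m _ (divr_gt0 e0 C1).
have := HN' (maxn N N') (leq_maxr _ _); rewrite -(fu (maxn N N') (leq_maxl _ _)).
rewrite ltr_pdivlMr // -linearB (snBC (gsn m)) => /lt_le_trans /(_ (bf _)).
move=> /lt_le_trans /(_ (_ : _ <= p m (l - u (maxn N N')) * (C + 1))).
by rewrite ltxx => -> //; rewrite mulrC ler_wpM2l ?(sn_ge0 (gsn _)) // lerDl.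
Qed.

(** The value at [x] of a continuous functional composed with a continuous operator is
    controlled by the distance from [x] to the zeros: kernels are closed. *)
Lemma form_closed (g : {scalar X}) (L : {linear X -> X}) x :
  bounded_form g -> bounded_operator L ->
  (forall m (e : K), 0 < e -> exists2 y, g (L y) = 0 & p m (y - x) < e) ->
  g (L x) = 0.
Proof.
move=> [m [C [C0 bg]]] bL near0; have [m' [C' [C'0 bL']]] := bL m.
apply/eqP; apply: contraT; rewrite -normr_gt0 => e0.
have C1 : 0 < C * C' + 1 by rewrite ltr_wpDl // mulr_ge0.
have [y gy0] := near0 m' _ (divr_gt0 e0 C1).
rewrite ltr_pdivlMr // -[g (L x)]subr0 -gy0 -!linearB => /lt_le_trans.
have := le_trans (bg _) (ler_wpM2l C0 (bL' (x - y))) => le_g /(_ _ le_g).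
rewrite (snBC (gsn m') x) => lt1.
have le2 : C * (C' * p m' (y - x)) <= p m' (y - x) * (C * C' + 1).
  by rewrite mulrA mulrC ler_wpM2l ?(sn_ge0 (gsn _)) // lerDl.
by have := lt_le_trans lt1 le2; rewrite ltxx.
Qed.

Lemma bounded_id_sub (L : {linear X -> X}) :
  bounded_operator L -> bounded_operator (id_sub L).
Proof.
move=> bL m; have [m' [C [C0 bC]]] := bL m; exists (maxn m m'), (1 + C).
split=> [|x]; first exact: addr_ge0.
apply: le_trans (snB (gsn m) _ _) _; rewrite mulrDl mul1r lerD //.
  by rewrite gsn_mono // leq_maxl.
by rewrite (le_trans (bC x)) // ler_wpM2l // gsn_mono // leq_maxr.
Qed.

Lemma bounded_idfun : bounded_operator idfun.
Proof. by move=> m; exists m, 1; split=> // x; rewrite mul1r. Qed.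

Lemma bounded_scale_form a (f : {scalar X}) :
  bounded_form f -> bounded_form (scale_form a f).
Proof.
move=> [m [C [C0 bC]]]; exists m, (`|a| * C); split=> [|x]; first exact: mulr_ge0.
by rewrite /= normrM -mulrA ler_wpM2l.
Qed.

Lemma bounded_form_comp (f : X -> K) (L : X -> X) :
  bounded_form f -> bounded_operator L -> bounded_form (f \o L).
Proof.
move=> [m [C [C0 bC]]] bL; have [m' [C' [C'0 bC']]] := bL m.
exists m', (C * C'); split=> [|x]; first exact: mulr_ge0.
by rewrite (le_trans (bC _)) // -mulrA ler_wpM2l.
Qed.

Lemma bounded_comp (L L' : X -> X) :
  bounded_operator L -> bounded_operator L' -> bounded_operator (L \o L').
Proof.
move=> bL bL' m; have [m1 [C1 [C10 b1]]] := bL m; have [m2 [C2 [C20 b2]]] := bL' m1.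
exists m2, (C1 * C2); split=> [|x]; first exact: mulr_ge0.
by rewrite (le_trans (b1 _)) // -mulrA ler_wpM2l.
Qed.

Lemma bounded_iter (T : X -> X) n :
  bounded_operator T -> bounded_operator (iter n T).
Proof.
move=> bT; elim: n => [|n IHn]; last exact: bounded_comp bT IHn.
exact: bounded_idfun.
Qed.

Lemma bounded_finite_rank (f : nat -> {scalar X}) (y : nat -> X) N :
  (forall i, (i < N)%N -> bounded_form (f i)) -> bounded_operator (finite_rank f y N).
Proof.
move=> + m /=; elim: N => [_|N IHN bf].
  by exists 0%N, 0; split=> // x; rewrite big_ord0 (sn0 (gsn m)) mul0r.
have [|m1 [C1 [C10 b1]]] := IHN; first by move=> i lti; apply: bf; exact: ltnW.
have [m2 [C2 [C20 b2]]] := bf N (ltnSn N).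
exists (maxn m1 m2), (C1 + C2 * p m (y N)).
have ym := sn_ge0 (gsn m) (y N); split=> [|x]; first by rewrite addr_ge0 ?mulr_ge0.
rewrite big_ord_recr /=; apply: le_trans (snD (gsn m) _ _) _; rewrite mulrDl lerD //.
  by rewrite (le_trans (b1 x)) // ler_wpM2l // gsn_mono // leq_maxl.
rewrite (snZ (gsn m)) mulrAC ler_wpM2r // (le_trans (b2 x)) // ler_wpM2l //.
by rewrite gsn_mono // leq_maxr.
Qed.

Lemma bounded_residual (f : nat -> {scalar X}) (x : nat -> X) n :
  (forall i, (i < n)%N -> bounded_form (f i)) -> bounded_operator (residual f x n).
Proof. by move=> bf; apply: bounded_id_sub; exact: bounded_finite_rank. Qed.

Lemma tends_le u l a m (c : K) N : tends u l ->
  (forall n, (N <= n)%N -> p m (u n - a) <= c) -> p m (l - a) <= c.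
Proof.
move=> ul le_c.
have c0 : 0 <= c by apply: le_trans (le_c N _) => //; exact: sn_ge0 (gsn m) _.
have rc : p m (l - a) \is Num.real by rewrite ger0_real // (sn_ge0 (gsn m)).
rewrite real_leNgt // ?(ger0_real c0) //; apply/negP => lt_c.
have e0 : 0 < p m (l - a) - c by rewrite subr_gt0.
have [N' HN'] := ul m _ e0; have := HN' (maxn N N') (leq_maxr _ _).
have := le_c (maxn N N') (leq_maxl _ _) => le1 lt2.
have := le_lt_trans (sn_tri (gsn m) (u (maxn N N')) l a) (ltr_leD _ le1).
move=> /(_ (p m (l - a) - c)); rewrite (snBC (gsn m) l) => /(_ lt2).
by rewrite subrK ltxx.
Qed.

(** The subtracted term of the bound is what makes the induction close. *)
Lemma telescope_geom u (C : K) m N n : (N <= n)%N ->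
  (forall i, (N <= i)%N -> p m (u i.+1 - u i) <= C * 2^-1 ^+ i) ->
  p m (u n - u N) <= C * (2 * 2^-1 ^+ N - 2 * 2^-1 ^+ n).
Proof.
move=> leNn inc; elim: n leNn => [|n IHn].
  by rewrite leqn0 => /eqP->; rewrite !subrr mulr0 (sn0 (gsn m)).
rewrite leq_eqVlt => /predU1P[->|leNn].
  by rewrite !subrr mulr0 (sn0 (gsn m)).
apply: le_trans (sn_tri (gsn m) (u n) _ _) _.
apply: le_trans (lerD (inc _ leNn) (IHn leNn)) _.
rewrite (geom_half K n) -mulrDr ler_wpM2l //; last first.
  by rewrite le_eqVlt; apply/orP; left; apply/eqP; ring.
have := le_trans (sn_ge0 (gsn m) _) (inc _ (leqnn N)).
by rewrite pmulr_lge0 // geom_gt0.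
Qed.

Hypothesis cp : seq_complete.

Lemma geometric_limit u (C : K) : 0 <= C ->
  (forall n, p n (u n.+1 - u n) <= C * 2^-1 ^+ n) ->
  exists2 l, tends u l
    & forall m N, (m <= N)%N -> p m (u N - l) <= C * (2 * 2^-1 ^+ N).
Proof.
move=> C0 inc.
have bnd m N n : (m <= N)%N -> (N <= n)%N -> p m (u n - u N) <= C * (2 * 2^-1 ^+ N).
  move=> lemN leNn; apply: le_trans (telescope_geom leNn _) _.
    by move=> i leNi; apply: le_trans (gsn_mono _ (leq_trans lemN leNi)) (inc i).
  by rewrite ler_wpM2l // lerBlDr lerDl mulr_ge0 // geom_ge0.
have [|l ul] := cp (u := u).
  move=> m e e0.
  have [N HN] := geometric_small archK (mulr_ge0 C0 (ler0n K 2)) (divr_gt0 e0 (ltr0n K 2)).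
  exists (maxn m N) => i j lei lej.
  apply: le_lt_trans (sn_tri (gsn m) (u (maxn m N)) _ _) _.
  rewrite (snBC (gsn m) (u (maxn m N))) [e](_ : _ = e / 2 + e / 2); last by field.
  have := HN _ (leq_maxr m N); rewrite -mulrA => small.
  by rewrite ltrD // (le_lt_trans _ small) // bnd // leq_maxl.
exists l => // m N lemN; rewrite (snBC (gsn m)).
by apply: (tends_le (N := N) ul) => n leNn; exact: bnd.
Qed.

(** The [n]-th term is small for [p n], hence for [p m] as soon as [m <= n]: the partial
    sums are Cauchy. That a single seminorm [p a] bounds all terms makes the limit
    continuous. *)
Lemma operator_series a (f : nat -> {scalar X}) (y : nat -> X) :
  (forall n x, `|f n x| <= p a x) ->
  (forall n x, `|f n x| * p n (y n) <= 2^-1 ^+ n * p a x) ->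
  exists L : {linear X -> X}, bounded_operator L /\
    forall x, tends (fun N => \sum_(n < N) f n x *: y n) (L x).
Proof.
move=> bf small; pose u x N := \sum_(n < N) f n x *: y n.
have /choice[L LP] x : exists l, tends (u x) l /\ forall m N, (m <= N)%N ->
    p m (u x N - l) <= p a x * (2 * 2^-1 ^+ N).
  have [n|l ul bl] := geometric_limit (u := u x) (sn_ge0 (gsn a) x); last by exists l.
  by rewrite /u big_ord_recr /= addrAC subrr add0r (snZ (gsn n)) [leRHS]mulrC.
have linL : linear L.
  move=> c x x'; apply: (tends_unique (proj1 (LP _))).
  have := tendsD (tendsZ c (proj1 (LP x))) (proj1 (LP x')).
  by congr tends; apply/funext => N; rewrite -(linearP (finite_rank f y N)).
exists (pack_operator linL); split=> [m|x]; last exact: (proj1 (LP x)).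
have [|m' [C [C0 bC]]] := @bounded_finite_rank f y m _ m.
  by move=> i _; exists a, 1; split=> // x; rewrite mul1r.
exists (maxn m' a), (C + 2 * 2^-1 ^+ m); split=> [|x].
  by rewrite addr_ge0 // mulr_ge0 // geom_ge0.
rewrite /= -[L x](subrKC (u x m)); apply: le_trans (snD (gsn m) _ _) _.
rewrite mulrDl lerD //.
  by rewrite (le_trans (bC x)) // ler_wpM2l // gsn_mono // leq_maxl.
rewrite (snBC (gsn m)) (le_trans (proj2 (LP x) _ _ (leqnn m))) // mulrC.
by rewrite ler_wpM2l ?mulr_ge0 ?geom_ge0 // gsn_mono // leq_maxr.
Qed.

End Graded.

(** * The Hahn-Banach theorem over the real and the complex field *)

(** Real scalars act through [iota], so that the same extension argument serves real and
    complex vector spaces. *)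
Section HahnBanach.
Variables (R : realType) (K : numFieldType) (iota : {rmorphism R -> K}).
Variables (X : lmodType K) (r : X -> R).
Hypothesis r_subadd : forall u v, r (u + v) <= r u + r v.
Hypothesis r_homog : forall (a : R) u, 0 <= a -> r (iota a *: u) = a * r u.

(** Graphs of partial linear functionals below [r]. Being single-valued is automatic: if
    [(0, c)] belongs to the graph then so does [(0, - c)], and [r 0 = 0] bounds both. *)
Definition dominated_graph (G : set (X * R)) :=
  (forall a u v, G u -> G v -> G (iota a *: u.1 + v.1, a * u.2 + v.2)) /\
  forall u, G u -> u.2 <= r u.1.

Let r0 : r 0 = 0.
Proof. by have := @r_homog 0 0 (lexx 0); rewrite scaler0 mul0r. Qed.

Lemma dominated_line x : dominated_graph [set (iota a *: x, a * r x) | a in setT].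
Proof.
split=> [a _ _ [b _ <-] [c _ <-]|_ [a _ <-]] /=.
  by exists (a * b + c); rewrite // rmorphD rmorphM scalerDl scalerA mulrDl mulrA.
have [a0|a0] := leP 0 a; first by rewrite r_homog.
have := r_subadd (iota a *: x) (iota (- a) *: x).
rewrite -scalerDl -rmorphD subrr rmorph0 scale0r r0 (@r_homog (- a)).
  by rewrite mulNr subr_ge0.
by rewrite oppr_ge0 ltW.
Qed.

(** By subadditivity [u.2 - r (u.1 - x) <= r (v.1 + x) - v.2] for all [u], [v] in [G]. Any [c]
    that separates the two sides is a suitable value at [x]; the proof takes the supremum
    of the left sides. *)
Lemma dominated_extension (G : set (X * R)) x : dominated_graph G -> G (0, 0) ->
  exists c, dominated_graph
    [set (u.1 + iota a *: x, u.2 + a * c) | a in setT & u in G].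
Proof.
move=> [linG domG] G00.
have scaleG a u : G u -> G (iota a *: u.1, a * u.2).
  by move=> Gu; have := linG a _ _ Gu G00; rewrite !addr0.
pose L := [set u.2 - r (u.1 - x) | u in G].
have L_ub v : G v -> ubound L (r (v.1 + x) - v.2).
  move=> Gv _ [u Gu <-]; rewrite lerBlDr addrAC lerBrDr.
  have := domG _ (linG 1 _ _ Gu Gv); rewrite rmorph1 scale1r mul1r => /le_trans.
  by apply; rewrite addrC -[u.1 + v.1](_ : (u.1 - x) + (v.1 + x) = _) ?r_subadd //
    -?addrA ?[v.1 + x]addrC ?addKr.
have supL : has_sup L.
  by split; [exists (0 - r (0 - x)), (0, 0) | exists (r (0 + x) - 0); apply: (L_ub (0, 0))].
exists (sup L); split=> [a _ _ [b _ [u Gu <-]] [c _ [v Gv <-]]|_ [a _ [u Gu <-]]] /=.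
  exists (a * b + c) => //; exists (iota a *: u.1 + v.1, a * u.2 + v.2); first exact: linG.
  congr (_, _) => /=; last by ring.
  by rewrite rmorphD rmorphM scalerDr scalerDl scalerA addrACA.
have [a0|a0|->] := ltgtP a 0; last first.
- by rewrite rmorph0 scale0r addr0 mul0r addr0 domG.
- have : sup L <= r (iota a^-1 *: u.1 + x) - a^-1 * u.2.
    by apply: ge_sup; [case: supL | apply: (L_ub (_, _)); exact: scaleG].
  rewrite -(ler_pM2l a0) mulrBr mulrA mulfV ?gt_eqF // mul1r lerBrDl.
  by rewrite -(r_homog _ (ltW a0)) scalerDr scalerA -rmorphM mulfV ?gt_eqF // rmorph1 scale1r.
have na0 : 0 < - a by rewrite oppr_gt0.
have : (- a)^-1 * u.2 - r (iota (- a)^-1 *: u.1 - x) <= sup L.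
  apply: sup_upper_bound => //.
  by exists (iota (- a)^-1 *: u.1, (- a)^-1 * u.2) => //; exact: scaleG.
rewrite -(ler_pM2l na0) mulrBr mulrA mulfV ?gt_eqF // mul1r lerBlDr -lerBlDl mulNr opprK.
rewrite -(r_homog _ (ltW na0)) scalerBr scalerA -rmorphM mulfV ?gt_eqF // rmorph1 scale1r.
by rewrite rmorphN scaleNr opprK.
Qed.

Lemma dominated_functional x0 : exists F : X -> R,
  [/\ forall u v, F (u + v) = F u + F v, forall a u, F (iota a *: u) = a * F u,
      forall u, F u <= r u & F x0 = r x0].
Proof.
pose G0 := [set (iota a *: x0, a * r x0) | a in setT].
have domG0 : dominated_graph G0 := dominated_line x0.
(* The line through [x0] is added to the members of the chains, which makes the union of
   the empty chain a dominated graph and prescribes the value at [x0]. *)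
have [C chC totC|A [PA maxA]] := @Zorn_bigcup _ [set A | dominated_graph (A `|` G0)].
  split=> [a u v|u [[B CB Bu]|G0u]]; last 2 first.
  - by have [_] := chC _ CB; apply; left.
  - by case: domG0 => _; apply.
  have in_chain B w : C B -> B w -> (\bigcup_(B in C) B `|` G0) w by left; exists B.
  have lift B : C B -> (B `|` G0) u -> (B `|` G0) v ->
      (\bigcup_(B in C) B `|` G0) (iota a *: u.1 + v.1, a * u.2 + v.2).
    move=> CB Bu Bv; have [linB _] := chC _ CB.
    by have [BB|GG] := linB a _ _ Bu Bv; [left; exists B | right].
  case=> [[B CB Bu]|G0u] [[B' CB' B'v]|G0v].
  - by have [sBB'|sB'B] := totC _ _ CB CB'; [apply: (lift B') | apply: (lift B)] => //;
      left => //; [exact: sBB' | exact: sB'B].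
  - by apply: (lift B) => //; [left|right].
  - by apply: (lift B') => //; [right|left].
  - by right; case: domG0 => linG0 _; exact: linG0.
set G := A `|` G0 in PA.
have [linG domG] := PA.
have G00 : G (0, 0) by right; exists 0; rewrite // rmorph0 scale0r mul0r.
have totG x : exists c, G (x, c).
  apply: contrapT => noc; have [c goodc] := dominated_extension x PA G00.
  set G' := [set _ | _ in _ & _ in _] in goodc.
  have sGG' : G `<=` G'.
    move=> u Gu; exists 0 => //; exists u => //.
    by rewrite rmorph0 scale0r mul0r !addr0 -surjective_pairing.
  apply: (maxA G').
    split; first by move=> u Au; apply: sGG'; left.
    move=> /(_ (x, c)) sA; apply: noc; exists c; left; apply: sA.
    by exists 1 => //; exists (0, 0); rewrite // rmorph1 scale1r mul1r !add0r.
  by rewrite /= (_ : G' `|` G0 = G') //; apply: setUidl => u G0u; apply: sGG'; right.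
have unG x c c' : G (x, c) -> G (x, c') -> c = c'.
  have half b b' : G (x, b) -> G (x, b') -> b <= b'.
    move=> Gb Gb'; have := domG _ (linG (-1) _ _ Gb' Gb).
    by rewrite /= rmorphN1 scaleN1r addNr r0 mulN1r addrC subr_le0.
  by move=> Gc Gc'; apply/le_anti; rewrite !half.
have [F GF] := choice totG; exists F; split=> [u v|a u|u|].
- by apply: unG (GF _) _; have := linG 1 _ _ (GF u) (GF v); rewrite /= rmorph1 scale1r mul1r.
- by apply: unG (GF _) _; have := linG a _ _ (GF u) G00; rewrite /= !addr0.
- by have := domG _ (GF u).
- by apply: unG (GF _) _; right; exists 1; rewrite // rmorph1 scale1r mul1r.
Qed.

End HahnBanach.

Definition has_norming_forms (K : numFieldType) (X : lmodType K) :=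
  forall (r : X -> K), is_seminorm r -> forall x,
    exists f : {scalar X}, (forall u, `|f u| <= r u) /\ `|f x| = r x.

Lemma norming_forms_real (R : realType) (X : lmodType R) : has_norming_forms X.
Proof.
move=> r sn_r x.
have [|a u a0|F [FD FZ Fr Fx]] := @dominated_functional R R idfun X r _ _ x.
- exact: snD sn_r.
- by rewrite (snZ sn_r) ger0_norm.
have linF : scalar F by move=> a u v; rewrite FD FZ.
exists (pack_form linF); split=> [u|]; last by rewrite /= Fx ger0_norm // (sn_ge0 sn_r).
rewrite ler_norml Fr andbT lerNl -(snN sn_r); apply: le_trans (Fr _).
by rewrite -scaleN1r FZ mulN1r.
Qed.

Lemma norming_forms_complex (R : realType) (X : lmodType R[i]) : has_norming_forms X.
Proof.
move=> r sn_r x; pose rr u := complex.Re (r u).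
have rE u : r u = (rr u)%:C%C.
  by have := sn_ge0 sn_r u; rewrite /rr; case: (r u) => a b; rewrite lecE /= => /andP[/eqP -> _].
have [u v|a u a0|F [FD FZ Fr Fx]] := @dominated_functional R R[i] (real_complex R) X rr _ _ x.
- by have := snD sn_r u v; rewrite !rE -rmorphD lecR.
- have := snZ sn_r a%:C%C u; rewrite !rE normc_def /= expr0n addr0 sqrtr_sqr.
  by rewrite ger0_norm // -rmorphM => /complexI.
(* [F] is the real part of the complex-linear functional sought. *)
pose J u := F ('i%C *: u); pose f u := (F u -i* J u)%C.
have FC a u : F (a *: u) = complex.Re a * F u + complex.Im a * J u.
  by rewrite {1}[a]complexE scalerDl FD -(FZ _ u) -FZ !scalerA mulrC.
have JC a u : J (a *: u) = complex.Re a * J u - complex.Im a * F u.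
  by rewrite {1}/J scalerA FC; case: a => a b /=; ring.
have linf : scalar f.
  move=> a u v; apply/eqP; rewrite eq_complex /f FD FC [J (_ + _)](_ : _ = J (a *: u) + J v).
    rewrite JC; case: a => a b /=; apply/andP; split; apply/eqP; ring.
  by rewrite /J scalerDr FD.
have Ref u : complex.Re (f u) = F u by [].
have le_f u : `|f u| <= r u.
  have [->|fu0] := eqVneq (f u) 0; first by rewrite normr0 (sn_ge0 sn_r).
  (* Rotating [u] makes the value of [f] real, and there [f] agrees with [F]. *)
  pose c := `|f u| / f u.
  have c1 : `|c| = 1 by rewrite normrM normfV normr_id mulfV // normr_eq0.
  have fc : f (c *: u) = `|f u|.
    by rewrite [LHS](scalarZ (pack_form linf)) /= /c mulfVK.
  have := Fr (c *: u); rewrite -Ref fc => le_r.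
  have := snZ sn_r c u; rewrite c1 mul1r => <-.
  by rewrite rE normc_def lecR; move: le_r; rewrite normc_def.
exists (pack_form linf); split=> //=; apply/le_anti; rewrite le_f /=.
by rewrite rE -Fx -Ref (le_trans _ (normc_ge_Re _)) // lecR ler_norm.
Qed.

Lemma archimedean_real (R : realType) : archimedean R.
Proof. by move=> x x0; exists (Num.truncn x).+1; exact: truncnS_gt. Qed.

Lemma archimedean_complex (R : realType) : archimedean (R[i] : numFieldType).
Proof.
move=> x x0; have Re0 : 0 <= complex.Re x by move: x0; rewrite lecE => /andP[].
have [n ltn] := archimedean_real Re0.
exists n; rewrite -(rmorph_nat (real_complex R) n).
by rewrite ltcE /= ltn andbT; move: x0; rewrite lecE => /andP[/eqP -> _].
Qed.

Lemma real_or_complex_archimedean (R : realType) (K : numFieldType) :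
  real_or_complex R K -> archimedean K.
Proof. by case=> ->; [exact: archimedean_real | exact: archimedean_complex]. Qed.

Lemma real_or_complex_norming (R : realType) (K : numFieldType) (X : lmodType K) :
  real_or_complex R K -> has_norming_forms X.
Proof.
case=> EK; case: _ / (esym EK) X => X; first exact: norming_forms_real.
exact: norming_forms_complex.
Qed.

(** * Translations of polynomials and unipotent operators *)

Section Translation.
Variable K : numFieldType.
Implicit Types (q : {poly K}) (t : K).

Definition translate t q := q \Po ('X + t%:P).

Definition difference q := translate 1 q - q.

Lemma translate_is_linear t : linear (translate t).
Proof. by move=> a q r; rewrite /translate comp_polyD comp_polyZ. Qed.

HB.instance Definition _ t :=
  GRing.isLinear.Build K {poly K} {poly K} *:%R (translate t) (translate_is_linear t).

Lemma difference_is_linear : linear difference.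
Proof. by move=> a q r; rewrite /difference linearP scalerBr opprD addrACA. Qed.

HB.instance Definition _ :=
  GRing.isLinear.Build K {poly K} {poly K} *:%R difference difference_is_linear.

Lemma translateM t q r : translate t (q * r) = translate t q * translate t r.
Proof. exact: comp_polyM. Qed.

Lemma translateXn t q n : translate t (q ^+ n) = translate t q ^+ n.
Proof. by elim: n => [|n IHn]; rewrite ?exprS ?translateM ?IHn // /translate comp_polyC. Qed.

Lemma translateX t : translate t 'X = 'X + t%:P.
Proof. exact: comp_polyX. Qed.

Lemma translate_translate s t q : translate s (translate t q) = translate (s + t) q.
Proof.
by rewrite /translate -comp_polyA comp_polyD comp_polyX comp_polyC polyCD addrA.
Qed.

Lemma translate0 q : translate 0 q = q.
Proof. by rewrite /translate addr0 comp_polyXr. Qed.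

Lemma size_difference q n : (size q <= n.+1)%N -> (size (difference q) <= n)%N.
Proof.
have szX : size ('X + 1%:P : {poly K}) = 2 by rewrite size_XaddC.
move=> szq; apply/leq_sizeP => j lenj; rewrite coefB.
have [ltj|gej] := ltnP j (size q); last first.
  by rewrite !nth_default ?subrr // size_comp_poly2.
have Ej : (size q).-1 = j by lia.
have := lead_coef_comp q; move=> /(_ ('X + 1%:P)); rewrite szX => /(_ isT).
rewrite lead_coefXaddC expr1n mulr1 /lead_coef size_comp_poly2 // Ej => ->.
by rewrite subrr.
Qed.

Lemma iter_difference_eq0 q n : (size q <= n)%N -> iter n difference q = 0.
Proof.
elim: n q => [|n IHn] q szq; first by apply/eqP; rewrite -size_poly_eq0 -leqn0.
by rewrite iterSr IHn // size_difference.
Qed.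

Definition binomial_poly j : {poly K} :=
  j`!%:R^-1 *: \prod_(i < j) ('X - i%:R%:P).

Lemma difference_binomial j : difference (binomial_poly j.+1) = binomial_poly j.
Proof.
rewrite /binomial_poly linearZ /= /difference.
have -> : translate 1 (\prod_(i < j.+1) ('X - i%:R%:P)) =
    ('X + 1) * \prod_(i < j) ('X - i%:R%:P).
  rewrite big_ord_recl translateM subr0 translateX; congr (_ * _).
  elim: j => [|j IHj]; first by rewrite !big_ord0 /translate comp_polyC.
  rewrite !big_ord_recr /= translateM IHj linearB /= translateX; congr (_ * _).
  rewrite /translate comp_polyC -addrA -polyCB /bump add1n -natr1 opprD.
  by rewrite [- _ - 1]addrC addrA subrr add0r polyCN.
rewrite big_ord_recr /=; set P := \prod_(i < j) _.
have -> : ('X + 1) * P - P * ('X - j%:R%:P) = j.+1%:R *: P.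
  by rewrite scaler_nat -[P *+ _]mulr_natr polyC_natr; ring.
rewrite scalerA; congr (_ *: _).
by rewrite factS natrM invfM mulrAC mulVf ?mul1r // pnatr_eq0.
Qed.

Lemma iter_difference_binomial j l :
  (iter l difference (binomial_poly j)).[0] = (l == j)%:R.
Proof.
have d0 : difference (binomial_poly 0) = 0.
  by rewrite /binomial_poly big_ord0 linearZ /= /difference /translate comp_polyC subrr scaler0.
have bin0 i : (binomial_poly i).[0] = (0 == i)%:R%N.
  case: i => [|i]; first by rewrite /binomial_poly big_ord0 fact0 invr1 scale1r hornerC.
  rewrite /binomial_poly big_ord_recl hornerZ hornerM hornerD hornerX hornerN hornerC.
  by rewrite oppr0 addr0 mul0r mulr0.
elim: l j => [|l IHl] j; first exact: bin0.
rewrite iterSr; case: j => [|j]; last by rewrite difference_binomial IHl.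
rewrite d0 (_ : iter l _ 0 = 0) ?horner0 //.
by elim: l {IHl} => [//|l IHl]; rewrite iterSr linear0.
Qed.

End Translation.

Section Chain.
Variables (K : numFieldType) (X : lmodType K) (p : nat -> X -> K).
Hypothesis archK : archimedean K.
Hypothesis gp : graded_seminorms p.

Lemma tends_scale0 (c : nat -> K) u l :
  (forall e : K, 0 < e -> exists N : nat, forall n, (N <= n)%N -> `|c n| < e) ->
  tends p u l -> tends p (fun n => c n *: u n) 0.
Proof.
move=> c0 ul m e e0.
have C1 : 0 < p m l + 1 by rewrite ltr_wpDl // (sn_ge0 (gsn gp m)).
have [N HN] := c0 _ (divr_gt0 e0 C1); have [N' HN'] := ul m _ ltr01.
exists (maxn N N') => n; rewrite geq_max => /andP[/HN lt1 /HN' lt2].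
rewrite subr0 (snZ (gsn gp m)).
have lt3 : p m (u n) < p m l + 1.
  rewrite addrC; apply: le_lt_trans (_ : p m (u n - l) + p m l < _).
    by apply: le_trans (snD (gsn gp m) _ _); rewrite subrK.
  by rewrite ltrD2r.
apply: le_lt_trans (_ : `|c n| * (p m l + 1) < _).
  by rewrite ler_wpM2l // ltW.
by rewrite -ltr_pdivlMr.
Qed.

Variables (T : {linear X -> X}) (y : nat -> X).
Hypothesis Ty0 : T (y 0) = y 0.
Hypothesis TyS : forall j, T (y j.+1) = y j.+1 + y j.

(** As [T - 1] lowers the index along the chain, Newton's expansion carries the difference
    operator to [T - 1], hence the translation by 1 to [T]. *)
Definition newton (q : {poly K}) : X :=
  \sum_(j < size q) (iter j (@difference K) q).[0] *: y j.

Lemma newton_wide n (q : {poly K}) : (size q <= n)%N ->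
  newton q = \sum_(j < n) (iter j (@difference K) q).[0] *: y j.
Proof.
move=> szq; rewrite /newton -(subnKC szq) big_split_ord /=.
rewrite [X in _ + X]big1 ?addr0 // => i _.
by rewrite iter_difference_eq0 ?horner0 ?scale0r // leq_addr.
Qed.

Lemma newton_is_linear : linear newton.
Proof.
move=> a q r; pose n := maxn (size (a *: q + r)) (maxn (size q) (size r)).
rewrite !(@newton_wide n) /n ?leq_max ?leqnn ?orbT // scaler_sumr -big_split /=.
apply: eq_bigr => i _; rewrite iter_linear.
by rewrite hornerD hornerZ scalerDl scalerA.
Qed.

HB.instance Definition _ :=
  GRing.isLinear.Build K {poly K} X *:%R newton newton_is_linear.

Lemma newton_binomial j : newton (binomial_poly K j) = y j.
Proof.
rewrite (@newton_wide (maxn (size (binomial_poly K j)) j.+1)) ?leq_maxl //.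
have ltj : (j < maxn (size (binomial_poly K j)) j.+1)%N by rewrite leq_maxr.
rewrite (bigD1 (Ordinal ltj)) //= iter_difference_binomial eqxx scale1r.
rewrite big1 ?addr0 // => i nij; rewrite iter_difference_binomial.
by rewrite -(inj_eq val_inj) /= in nij; rewrite (negPf nij) scale0r.
Qed.

Lemma newton_translate1 q : T (newton q) = newton (translate 1 q).
Proof.
have -> : translate 1 q = q + difference q by rewrite addrC subrK.
rewrite linearD /= [newton (difference q)](@newton_wide (size q)); last first.
  by rewrite size_difference.
rewrite (@newton_wide (size q).+1 q) // linear_sum !big_ord_recl /=.
rewrite linearZ /= Ty0 -addrA; congr (_ + _).
rewrite -big_split /=; apply: eq_bigr => i _.
by rewrite linearZ /= TyS scalerDr -iterS iterSr.
Qed.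

Lemma newton_translate n q : iter n T (newton q) = newton (translate n%:R q).
Proof.
elim: n => [|n IHn]; first by rewrite translate0.
by rewrite iterS IHn newton_translate1 translate_translate nat1r.
Qed.

(** By induction on [m]: each further factor adds a null multiple of a convergent
    sequence. *)
Lemma newton_perturb (c : nat -> K) (q : {poly K}) m :
  (forall e : K, 0 < e -> exists N : nat, forall n, (N <= n)%N -> `|c n| < e) ->
  tends p (fun n => newton (q * (1 + c n *: 'X) ^+ m)) (newton q).
Proof.
move=> c0; elim: m q => [|m IHm] q.
  by under eq_fun do rewrite expr0 mulr1; exact: tends_cst.
have := tendsD gp (IHm q) (tends_scale0 c0 (IHm (q * 'X))).
rewrite addr0; congr (tends p); apply/funext => n.
rewrite -linearZ /= -linearD /=; congr newton.
by rewrite exprS mulrA mulrDr mulr1 mulrDl -!scalerAr -scalerAl.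
Qed.

(** Mixing for a single pair of points, with the perturbations of [u] confined to [F]. *)
Definition steerable (F : X -> Prop) u v :=
  exists w : nat -> X, [/\ forall n, F (w n - u), tends p w u
    & tends p (fun n => iter n T (w n)) v].

(** Steerable pairs form a linear subspace, so it is enough to steer basis vectors to 0 and
    0 to basis vectors. *)
Lemma steerable_linear (F : X -> Prop) :
  (forall a x x', F x -> F x' -> F (a *: x + x')) ->
  forall a u v u' v', steerable F u v -> steerable F u' v' ->
    steerable F (a *: u + u') (a *: v + v').
Proof.
move=> linF a u v u' v' [w [Fw wu wv]] [w' [Fw' wu' wv']].
exists (fun n => a *: w n + w' n); split.
- by move=> n; rewrite opprD addrACA -scalerBr; exact: linF.
- exact: tendsD (tendsZ gp a wu) wu'.
have := tendsD gp (tendsZ gp a wv) wv'; congr (tends p); apply/funext => n.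
by rewrite iter_linear.
Qed.


Lemma inv_nat_small e : 0 < e -> exists N : nat, forall n : nat,
  (N <= n)%N -> `|n%:R^-1 : K| < e.
Proof.
move=> e0; have [N HN] := harmonic_small archK ler01 e0; exists N.+1 => -[//|n].
by rewrite ltnS => /HN; rewrite mul1r ger0_norm // invr_ge0.
Qed.

Section Steering.
Variable F : X -> Prop.
Hypothesis linF : forall a x x', F x -> F x' -> F (a *: x + x').
Hypothesis Fy : forall j, F (y j.+1).

(** The coefficient of [y 0] in Newton's expansion is the value at 0. *)
Lemma steer_newton_root (q : {poly K}) : q.[0] = 0 -> F (newton q).
Proof.
have F0 : F 0 by have := linF (-1) (Fy 0) (Fy 0); rewrite scaleN1r addNr.
rewrite /newton => q0; elim/big_rec: _ => // i x _ Fx; case: i => -[|i] lti.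
  by rewrite /= q0 scale0r add0r.
exact: (linF _ (Fy i)).
Qed.

(** The translation by [n] moves the root of [1 - X / n] to the origin. *)
Lemma translate_affine n : (0 < n)%N ->
  translate n%:R (1 + (- n%:R^-1) *: 'X) = - (n%:R^-1%:P * 'X) :> {poly K}.
Proof.
move=> n0; have n1 : n%:R^-1 * n%:R = 1 :> K by rewrite mulVf // pnatr_eq0 -lt0n.
rewrite linearD linearZ /= translateX [translate _ 1]comp_polyC.
rewrite -mul_polyC polyCN mulrDr mulNr [in X in _ + X]mulNr -polyCM n1.
by rewrite addrCA subrr addr0.
Qed.

Lemma X_addC_affine n : (0 < n)%N ->
  'X + n%:R%:P = n%:R%:P * (1 + n%:R^-1 *: 'X) :> {poly K}.
Proof.
move=> n0; have n1 : n%:R * n%:R^-1 = 1 :> K by rewrite mulfV // pnatr_eq0 -lt0n.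
by rewrite mulrDr mulr1 -mul_polyC mulrA -polyCM n1 mul1r addrC.
Qed.

Lemma affine_units n i : (0 < n)%N ->
  n%:R%:P ^+ i * n%:R^-1%:P ^+ i = 1 :> {poly K}.
Proof. by move=> n0; rewrite -exprMn -polyCM mulfV ?pnatr_eq0 -?lt0n // expr1n. Qed.

(** The witness is [X^i (1 - X/n)^(i+1)]: the translation by [n] turns it into
    [(X + n)^i (- X/n)^(i+1)], that is [+-(1/n) X^(i+1) (1 + X/n)^i]. *)
Lemma steer_away_monomial i : steerable F (newton 'X^i) 0.
Proof.
exists (fun n => newton ('X^i * (1 + (- n%:R^-1) *: 'X) ^+ i.+1)); split.
- move=> n; rewrite -linearB; apply: steer_newton_root.
  by rewrite !(hornerE, horner_exp) expr1n mulr1 subrr.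
- by apply: newton_perturb => e /inv_nat_small[N HN]; exists N => n /HN; rewrite normrN.
have c0 (e : K) : 0 < e -> exists N : nat, forall n : nat, (N <= n)%N ->
    `|(-1) ^+ i.+1 * n%:R^-1 : K| < e.
  move=> /inv_nat_small[N HN]; exists N => n /HN.
  by rewrite normrM normrX normrN1 expr1n mul1r.
have := tends_scale0 c0 (newton_perturb 'X^(i.+1) i inv_nat_small).
apply: (tends_eq_from (N := 1)) => n n0; rewrite newton_translate translateM.
rewrite !translateXn translateX (translate_affine n0) -linearZ; congr newton.
rewrite X_addC_affine // [in RHS]exprMn [in RHS]exprNn [(_ * 'X) ^+ _]exprMn -!mul_polyC polyCM.
rewrite rmorphXn /= polyCN polyC1; move: (affine_units i n0).
move: (n%:R%:P) (n%:R^-1%:P) => a b ab; rewrite -[LHS]mul1r -{1}ab.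
rewrite [b ^+ i.+1]exprS; move: (a ^+ i) (b ^+ i) (_ ^+ i) ((-1) ^+ _) ('X^_).
by move=> *; ring.
Qed.

(** The witness [+-(1/n) X^(i+1) (1 - X/n)^i] is the translate by [- n] of
    [X^i (1 + X/n)^(i+1)]. *)
Lemma steer_towards_monomial i : steerable F 0 (newton 'X^i).
Proof.
exists (fun n => ((-1) ^+ i * n%:R^-1) *: newton ('X^(i.+1) * (1 + (- n%:R^-1) *: 'X) ^+ i)).
split.
- move=> n; rewrite subr0 -linearZ; apply: steer_newton_root.
  by rewrite hornerZ hornerM hornerXn expr0n mul0r mulr0.
- apply: tends_scale0.
    move=> e /inv_nat_small[N HN]; exists N => n /HN.
    by rewrite normrM normrX normrN1 expr1n mul1r.
  by apply: newton_perturb => e /inv_nat_small[N HN]; exists N => n /HN; rewrite normrN.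
have := newton_perturb 'X^i i.+1 inv_nat_small.
apply: (tends_eq_from (N := 1)) => n n0; rewrite -linearZ newton_translate.
rewrite linearZ /= translateM.
rewrite !translateXn translateX (translate_affine n0); congr newton.
rewrite X_addC_affine // [(- (_ * 'X)) ^+ _]exprNn [(_ * 'X) ^+ _]exprMn.
rewrite [in RHS]exprMn -!mul_polyC polyCM.
rewrite rmorphXn /= polyCN polyC1; move: (affine_units i.+1 n0).
move: (n%:R%:P) (n%:R^-1%:P) => a b ab.
have s1 : (-1) ^+ i * (-1) ^+ i = 1 :> {poly K} by rewrite -exprMn mulrNN mulr1 expr1n.
rewrite -[LHS]mul1r -{1}ab -[LHS]mul1r -{1}s1 [b ^+ i.+1]exprS.
move: (_ ^+ i.+1) ((-1) ^+ _) ('X^_) (b ^+ i) (a ^+ i.+1).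
by move=> *; ring.
Qed.

Lemma steerable_chain j : steerable F (y j) 0 /\ steerable F 0 (y j).
Proof.
suff st (q : {poly K}) : steerable F (newton q) 0 /\ steerable F 0 (newton q).
  by rewrite -newton_binomial.
have F0 : F 0 by have := linF (-1) (Fy 0) (Fy 0); rewrite scaleN1r addNr.
rewrite -[q]coefK poly_def; elim/big_rec: _ => [|i r _ [IH1 IH2]].
  rewrite linear0.
  suff st0 : steerable F 0 0 by [].
  exists (fun=> 0); split=> [n||]; [by rewrite subrr | exact: tends_cst |].
  by under eq_fun do rewrite iter_linear0; exact: tends_cst.
rewrite linearP; split.
  by have := steerable_linear linF q`_i (steer_away_monomial i) IH1; rewrite scaler0 addr0.
by have := steerable_linear linF q`_i (steer_towards_monomial i) IH2; rewrite scaler0 addr0.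
Qed.

End Steering.
End Chain.

(** * Biorthogonal systems bounded by one seminorm *)

Section TotalForms.
Variables (K : numFieldType) (X : lmodType K) (p : nat -> X -> K).
Hypothesis gp : graded_seminorms p.
Hypothesis normX : has_norming_forms X.

(** Functionals norming a dense sequence separate points: if [D j] is within
    [p m x / 2] of [x], a functional norming [D j] cannot vanish at [x]. *)
Lemma total_forms (D : nat -> X) : approximating p D ->
  exists g : nat -> {scalar X}, (forall j, bounded_form p (g j)) /\
    forall x, (forall j, g j x = 0) -> x = 0.
Proof.
move=> denseD.
have /choice[G GP] (mj : nat * nat) : exists f : {scalar X},
    (forall u, `|f u| <= p mj.1 u) /\ `|f (D mj.2)| = p mj.1 (D mj.2).
  exact: normX (gsn gp _) _.
exists (fun l => G (odflt (0, 0)%N (unpickle l))); split=> [j|x g0].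
  pose mj : nat * nat := odflt (0, 0)%N (unpickle j).
  by exists mj.1, 1; split=> // u; rewrite mul1r; case: (GP mj).
case: gp => _ _; apply=> m; apply/eqP; apply: contraT; rewrite -(sn_gt0 (gsn gp m)) => px0.
have [j _ near_x] := denseD x m (p m x / 2) 0 (divr_gt0 px0 (ltr0n K 2)).
have [le_p Gj] := GP (m, j).
have := le_p (D j - x); rewrite linearB /=.
have -> : G (m, j) x = 0 by have := g0 (pickle (m, j)); rewrite pickleK.
rewrite subr0 Gj /= => lt1; have := sn_tri (gsn gp m) (D j) x 0.
rewrite !subr0 (snBC (gsn gp m)) => le2.
have := le_lt_trans le2 (ltrD near_x (le_lt_trans lt1 near_x)).
by rewrite (_ : _ + _ = p m x) ?ltxx //; field.
Qed.

End TotalForms.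

Section AdaptedSystem.
Variables (K : numFieldType) (X : lmodType K) (p : nat -> X -> K).
Hypothesis archK : archimedean K.
Hypothesis gp : graded_seminorms p.
Hypothesis normX : has_norming_forms X.
Variable a : nat.
Hypothesis wide : forall n (f : nat -> {scalar X}), (forall i, bounded_form p (f i)) ->
  exists2 x, (forall i, (i < n)%N -> f i x = 0) & p a x != 0.
Variables (D : nat -> X) (g : nat -> {scalar X}).
Hypothesis bounded_g : forall j, bounded_form p (g j).

(** The two estimates make the series of rank one operators built on the system converge.
    At even indices the vectors are killed by more and more of the total sequence [g]; this
    is what makes the even coordinates separate points in [even_coordinates_total]. At odd
    indices the span is brought close to the dense sequence [D]. *)
Definition adapted (xs : nat -> X) (fs : nat -> {scalar X}) n (x : X) (f : {scalar X}) :=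
  [/\ dual_extension xs fs n x f,
      forall v, `|f v| <= 2^-1 ^+ n.+1 * p a v,
      forall i v, (i < n)%N -> `|f v| * p n (xs i) <= 2^-1 ^+ n * p a v,
      ~~ odd n -> forall j, (j < n)%N -> g j x = 0
    & odd n -> exists (c : nat -> K) (b : K),
        p n./2 (\sum_(i < n) c i *: xs i + b *: x - D n./2) <= 2^-1 ^+ n./2].

(** A functional norming [x], corrected so as to vanish at the earlier vectors. Making it as
    small as required costs only a larger multiple of [x]. *)
Lemma dual_form (xs : nat -> X) (fs : nat -> {scalar X}) n x :
  (forall i j, (i < n)%N -> (j < n)%N -> fs i (xs j) = (i == j)%:R) ->
  (forall i v, (i < n)%N -> `|fs i v| <= p a v) ->
  (forall i, (i < n)%N -> fs i x = 0) -> p a x != 0 ->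
  exists b (f : {scalar X}),
    [/\ b != 0, f (b *: x) = 1, forall i, (i < n)%N -> f (xs i) = 0,
        forall v, `|f v| <= 2^-1 ^+ n.+1 * p a v
      & forall i v, (i < n)%N -> `|f v| * p n (xs i) <= 2^-1 ^+ n * p a v].
Proof.
move=> bio bfs fsx pax0; have [h [hle hx]] := normX (gsn gp a) x.
have hx0 : h x != 0 by rewrite -normr_eq0 hx.
pose k : {scalar X} := h \o residual fs xs n.
have k_root j : (j < n)%N -> k (xs j) = 0.
  by move=> ltj; rewrite -(linear0 h) -(residual_root bio ltj).
have kx : k x = h x by rewrite -{2}(residual_fixed xs fsx).
pose C := 1 + \sum_(i < n) p a (xs i).
have C1 : 1 <= C by rewrite lerDl sumr_ge0 // => i _; exact: sn_ge0 (gsn gp a) _.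
have k_le v : `|k v| <= C * p a v.
  apply: le_trans (hle _) (le_trans (snB (gsn gp a) _ _) _); rewrite mulrDl mul1r lerD //.
  rewrite mulr_suml; apply: le_trans (sn_sum (gsn gp a) _ _) _; apply: ler_sum => i _.
  by rewrite (snZ (gsn gp a)) mulrC ler_wpM2l ?bfs // (sn_ge0 (gsn gp a)).
pose P := 1 + \sum_(i < n) p n (xs i).
have P1 : 1 <= P by rewrite lerDl sumr_ge0 // => i _; exact: sn_ge0 (gsn gp n) _.
have C0 : 0 < C by exact: lt_le_trans ltr01 C1.
have P0 : 0 < P by exact: lt_le_trans ltr01 P1.
pose mu := 2^-1 ^+ n.+1 / (C * P).
have mu0 : 0 < mu by rewrite divr_gt0 ?geom_gt0 ?mulr_gt0.
have f_le v : `|mu * k v| * P <= 2^-1 ^+ n.+1 * p a v.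
  rewrite normrM (gtr0_norm mu0) [leRHS](_ : _ = mu * (C * p a v) * P).
    by rewrite ler_pM2r // ler_pM2l.
  by rewrite /mu; field; rewrite !gt_eqF.
exists (mu * h x)^-1, (scale_form mu k); split.
- by rewrite invr_eq0 mulf_neq0 // gt_eqF.
- by rewrite linearZ scale_formE kx /= mulVf // mulf_neq0 // gt_eqF.
- by move=> j ltj; rewrite scale_formE k_root ?mulr0.
- by move=> v; apply: le_trans (f_le v); rewrite ler_peMr.
move=> i v lti /=; apply: le_trans (_ : `|mu * k v| * P <= _).
  rewrite ler_wpM2l // /P (bigD1 (Ordinal lti)) //= addrCA lerDl addr_ge0 //.
  by rewrite sumr_ge0 // => j _; exact: sn_ge0 (gsn gp n) _.
by rewrite (le_trans (f_le v)) // ler_wpM2r ?(sn_ge0 (gsn gp a)) // geom_le.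
Qed.

Lemma adapted_step xs fs n : (forall i, (i < n)%N -> adapted xs fs i (xs i) (fs i)) ->
  exists x f, adapted xs fs n x f.
Proof.
move=> ad.
have bio i j : (i < n)%N -> (j < n)%N -> fs i (xs j) = (i == j)%:R.
  by apply: dual_extension_biorthogonal => k /ad[].
have bfs i v : (i < n)%N -> `|fs i v| <= p a v.
  move=> lti; have [_ le_f _ _ _] := ad _ lti; apply: le_trans (le_f v) _.
  by rewrite ler_piMl ?(sn_ge0 (gsn gp a)) // -(expr0 (2^-1)) geom_le.
pose phi i := if (i < n)%N then fs i else g (i - n).
have bounded_phi i : bounded_form p (phi i).
  rewrite /phi; case: ltnP => // lti; exists a, 1; split=> // v.
  by rewrite mul1r bfs.
have [e phi_e pe0] := wide (n + n) bounded_phi.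
have fs_e i : (i < n)%N -> fs i e = 0.
  by move=> lti; have := phi_e i; rewrite /phi lti ltn_addr //; apply.
case oddn : (odd n); last first.
  have [b [f [b0 fx fxs f_le f_small]]] := dual_form bio bfs fs_e pe0.
  exists (b *: e), f; split=> //; last by rewrite oddn.
    by split=> // i lti; rewrite linearZ /= fs_e ?mulr0.
  move=> _ j ltj; rewrite linearZ /=; have := phi_e (n + j)%N.
  by rewrite /phi ltn_add2l ltj ltnNge leq_addr /= addKn => -> //; rewrite mulr0.
set d := D n./2; pose rd := residual fs xs n d.
have fs_rd i : (i < n)%N -> fs i rd = 0 by move=> lti; exact: residual_null.
pose h := 2^-1 ^+ n./2 / (1 + p n./2 e).
have pe1 : 0 < 1 + p n./2 e by rewrite ltr_pwDl // (sn_ge0 (gsn gp _)).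
have h0 : 0 < h by rewrite divr_gt0 ?geom_gt0.
(* Approximating [d] may leave a remainder on which [p a] vanishes; a small multiple of
   [e] repairs this. *)
have [c [c_small pax0]] : exists c, p n./2 (c *: e) <= 2^-1 ^+ n./2 /\ p a (rd + c *: e) != 0.
  have [rd0|rd0] := eqVneq (p a rd) 0; last first.
    by exists 0; rewrite scale0r addr0 (sn0 (gsn gp _)) geom_ge0.
  exists h; rewrite (snZ (gsn gp _)) (gtr0_norm h0); split.
    rewrite /h mulrAC ler_pdivrMr // ler_wpM2l ?geom_ge0 // lerDr //.
  apply: contra_neq pe0 => pz; have := snB (gsn gp a) (rd + h *: e) rd.
  rewrite pz rd0 addr0 addrAC subrr add0r (snZ (gsn gp a)) (gtr0_norm h0) pmulr_rle0 //.
  by move=> le0; apply/le_anti; rewrite le0 (sn_ge0 (gsn gp a)).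
have fsx i : (i < n)%N -> fs i (rd + c *: e) = 0.
  by move=> lti; rewrite linearD linearZ /= fs_rd // fs_e // mulr0 addr0.
have [b [f [b0 fx fxs f_le f_small]]] := dual_form bio bfs fsx pax0.
exists (b *: (rd + c *: e)), f; split=> //; last 2 first.
- by rewrite oddn.
- move=> _; exists (fun i => fs i d), b^-1.
  by rewrite scalerA mulVf // scale1r -/d addrA /rd subrKC addrAC subrr add0r.
by split=> // i lti; rewrite linearZ /= fsx ?mulr0.
Qed.

Lemma adapted_system : exists (x : nat -> X) (f : nat -> {scalar X}),
  forall n, adapted x f n (x n) (f n).
Proof.
pose A := (X * {scalar X})%type; have A0 : A by exact: (0, g 0).
pose P (s : seq A) (y : A) :=
  adapted (fun i => (nth A0 s i).1) (fun i => (nth A0 s i).2) (size s) y.1 y.2.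
have ext xs fs xs' fs' n x f :
    (forall i, (i < n)%N -> xs i = xs' i) -> (forall i, (i < n)%N -> fs i = fs' i) ->
    adapted xs fs n x f -> adapted xs' fs' n x f.
  move=> Ex Ef [dual f_le small even_n odd_n].
  split=> //; first exact: dual_extension_ext dual.
    by move=> i v lti; rewrite -Ex // small.
  move=> /odd_n[c [b le_c]]; exists c, b.
  by under eq_bigr => i _ do rewrite -Ex //.
have [s ad|u uP] := @sequential_choice A A0 P.
  have [|x [f xf]] := @adapted_step (fun i => (nth A0 s i).1) (fun i => (nth A0 s i).2) (size s).
    move=> i lti; have := ad i lti; rewrite /P size_takel ?(ltnW lti) //.
    by apply: ext => j ltj; rewrite nth_take.
  by exists (x, f).
exists (fun n => (u n).1), (fun n => (u n).2) => n; have := uP n.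
by rewrite /P size_mkseq; apply: ext => i lti; rewrite nth_mkseq.
Qed.

End AdaptedSystem.

(** * Vectors with independent universal orbits *)

Section UniversalVectors.
Variables (K : numFieldType) (X : lmodType K) (p : nat -> X -> K).
Hypothesis archK : archimedean K.
Hypothesis gp : graded_seminorms p.
Hypothesis cp : seq_complete p.
Variable T : {linear X -> X}.
Hypothesis bT : bounded_operator p T.
Variable F : X -> Prop.
Hypothesis linF : forall a x x', F x -> F x' -> F (a *: x + x').
Hypothesis F0 : F 0.
Variable d : nat -> X.
Hypothesis denseD : approximating p d.
Hypothesis steerF : forall u l, F u -> steerable p T F u (d l) /\ steerable p T F u 0.

(** Stage [l] moves the first vectors a little, keeping their first [N] iterates close to what
    they were, so that at a later time [n] one of them is near its target and the others are
    near 0. *)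
Lemma steering_step l (z : nat -> X) N k0 j : (forall k, F (z k)) ->
  exists (z' : nat -> X) n, [/\ forall k, F (z' k), (N <= n)%N,
    forall k i, (i <= N)%N -> p l (iter i T (z' k - z k)) <= 2^-1 ^+ l,
    forall k, (k <= l)%N ->
      p l (iter n T (z' k) - (if k == k0 then d j else 0)) <= 2^-1 ^+ l
    & forall k, (l < k)%N -> z' k = z k].
Proof.
move=> Fz; pose tgt k := if k == k0 then d j else 0.
have /choice[W WP] k : exists w : nat -> X, [/\ forall n, F (w n - z k),
    tends p w (z k) & tends p (fun n => iter n T (w n)) (tgt k)].
  by have [Sd S0] := steerF j (Fz k); rewrite /tgt; case: eqP.
have g0 := geom_gt0 K l.
have [N1 HN1] : exists N1 : nat, forall n k, (N1 <= n)%N -> (k <= l)%N ->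
    forall i, (i <= N)%N -> p l (iter i T (W k n - z k)) < 2^-1 ^+ l.
  apply: (@eventually_all (fun k n => forall i, (i <= N)%N -> _)) => k.
  suff [N1 HN1] : exists N1 : nat, forall n i, (N1 <= n)%N -> (i <= N)%N ->
      p l (iter i T (W k n - z k)) < 2^-1 ^+ l.
    by exists N1 => n leNn i; exact: HN1.
  apply: (@eventually_all (fun i n => _)) => i.
  have [_ Wz _] := WP k.
  have [m [C [C0 bC]]] := bounded_iter i bT l.
  have C1 : 0 < C + 1 by rewrite ltr_wpDl.
  have [N1 HN1] := Wz m _ (divr_gt0 g0 C1); exists N1 => n /HN1.
  rewrite ltr_pdivlMr // mulrC; apply: le_lt_trans; apply: le_trans (bC _) _.
  by rewrite ler_wpM2r ?(sn_ge0 (gsn gp m)) // lerDl.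
have [N2 HN2] : exists N2 : nat, forall n k, (N2 <= n)%N -> (k <= l)%N ->
    p l (iter n T (W k n) - tgt k) < 2^-1 ^+ l.
  by apply: (@eventually_all (fun k n => _)) => k; have [_ _ /(_ l _ g0)] := WP k.
pose n := maxn N (maxn N1 N2).
exists (fun k => if (k <= l)%N then W k n else z k), n; split.
- move=> k; case: ifP => // _; have [/(_ n) FW _ _] := WP k.
  by rewrite -[W k n](subrK (z k)) -[_ - _]scale1r; exact: linF.
- exact: leq_maxl.
- move=> k i lei; case: ifP => lekl; last first.
    by rewrite subrr iter_linear0 (sn0 (gsn gp l)) geom_ge0.
  by apply: ltW; apply: HN1; rewrite // /n !leq_max leqnn orbT.
- by move=> k lekl; rewrite lekl ltW // HN2 // /n !leq_max leqnn !orbT.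
by move=> k; rewrite ltnNge => /negPf->.
Qed.

Lemma steering_sequence (k0 j : nat -> nat) : exists (z : nat -> nat -> X) (N : nat -> nat),
  [/\ forall l k, F (z l k), forall l k, (l <= k)%N -> z l k = 0,
      forall l l', (l <= l')%N -> (N l <= N l')%N,
      forall l k i, (i <= N l)%N -> p l (iter i T (z l.+1 k - z l k)) <= 2^-1 ^+ l
    & forall l k, (k <= l)%N ->
        p l (iter (N l.+1) T (z l.+1 k) - (if k == k0 l then d (j l) else 0)) <= 2^-1 ^+ l].
Proof.
have /choice[step stepP] (s : nat * ((nat -> X) * nat)) : exists z' : (nat -> X) * nat,
    let l := s.1 in let z := s.2.1 in let N := s.2.2 in
    (forall k, F (z k)) -> [/\ forall k, F (z'.1 k), (N <= z'.2)%N,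
    forall k i, (i <= N)%N -> p l (iter i T (z'.1 k - z k)) <= 2^-1 ^+ l,
    forall k, (k <= l)%N ->
      p l (iter z'.2 T (z'.1 k) - (if k == k0 l then d (j l) else 0)) <= 2^-1 ^+ l
    & forall k, (l < k)%N -> z'.1 k = z k].
  case: s => l [z N] /=; have [Fz|nFz] := pselect (forall k, F (z k)); last by exists (z, N).
  by have [z' [n H]] := steering_step l N (k0 l) (j l) Fz; exists (z', n).
pose s := fix s l := if l is l'.+1 then step (l', s l') else (fun=> 0, 0%N).
have Fs l k : F ((s l).1 k).
  by elim: l k => [|l IHl] //= k; have [] := stepP (l, s l) IHl.
have sP l := stepP (l, s l) (Fs l).
exists (fun l => (s l).1), (fun l => (s l).2); split=> //.
- by elim=> [//|l IHl] k ltlk; have [_ _ _ _ /= ->] := sP l; rewrite ?IHl // ltnW.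
- move=> l l' /subnKC<-; elim: (l' - l)%N => [|n IHn]; first by rewrite addn0.
  by rewrite addnS (leq_trans IHn) //; have [] := sP (l + n)%N.
- by move=> l; have [] := sP l.
by move=> l; have [] := sP l.
Qed.

(** The vectors sought are the limits of the stages. All increments after stage [l] are small
    under the iterate reached at stage [l], so what that stage achieved survives. Each pair of
    an index and a target is served at arbitrarily late stages. *)
Lemma universal_vectors : exists zeta : nat -> X,
  [/\ forall f : {scalar X}, bounded_form p f -> (forall x, F x -> f x = 0) ->
        forall k, f (zeta k) = 0,
      forall k, p k (zeta k) <= 2 * 2^-1 ^+ k
    & forall k0 y m (e : K), 0 < e -> exists n, forall k,
        p m (iter n T (zeta k) - (if k == k0 then y else 0)) < e].
Proof.
have [c cP] := recurrent_enumeration (0, 0)%N.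
have [z [N [Fz z0 monoN inc hit]]] :=
  steering_sequence (fun l => (c l).1) (fun l => (c l).2).
have /choice[zeta zP] k : exists l, tends p (fun n => z n k) l /\
    forall m n, (m <= n)%N -> p m (z n k - l) <= 1 * (2 * 2^-1 ^+ n).
  have [n|l ul bl] := geometric_limit (u := fun n => z n k) archK gp cp ler01; last by exists l.
  by rewrite mul1r; apply: (inc n k 0).
have zlim k := proj1 (zP k).
exists zeta; split.
- move=> f bf f0 k; apply: (tends_form (N := 0) gp bf (zlim k)) => n _; exact: f0.
- move=> k; have := proj2 (zP k) k k (leqnn k).
  by rewrite z0 // sub0r (snN (gsn gp k)) mul1r.
have close l k : ((c l).1 <= l)%N ->
    p l (iter (N l.+1) T (zeta k) - (if k == (c l).1 then d (c l).2 else 0)) <= 3 * 2^-1 ^+ l.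
  move=> lec; set tgt := if _ then _ else _.
  have first_l : p l (iter (N l.+1) T (z l.+1 k) - tgt) <= 2^-1 ^+ l.
    have [lekl|ltlk] := leqP k l; first exact: hit.
    rewrite z0 // iter_linear0 /tgt; case: eqP => [Ek|_].
      by move: lec; rewrite -Ek leqNgt ltlk.
    by rewrite subrr (sn0 (gsn gp l)) geom_ge0.
  have lim_iter := tends_operator gp (T := pack_operator (iter_linear T (N l.+1)))
    (bounded_iter (N l.+1) bT) (zlim k).
  apply: (tends_le gp (N := l.+1) lim_iter) => n ltln /=.
  apply: le_trans (sn_tri (gsn gp l) (iter (N l.+1) T (z l.+1 k)) _ _) _.
  rewrite [leRHS](_ : _ = 2 * 2^-1 ^+ l + 2^-1 ^+ l); [rewrite lerD //|by ring].
  have := telescope_geom gp (u := fun n => iter (N l.+1) T (z n k)) (C := 1) (m := l) ltln.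
  move=> H; apply: le_trans (H _) _ => [i lei|].
    rewrite mul1r -[_ - _](_ : iter (N l.+1) T (z i.+1 k - z i k) = _); last first.
      by rewrite -scaleN1r addrC iter_linear scaleN1r addrC.
    apply: le_trans (gsn_mono gp _ (ltnW lei)) _.
    by apply: inc; exact: monoN.
  rewrite mul1r lerBlDr ler_wpDr ?mulr_ge0 ?geom_ge0 // ler_wpM2l // geom_le //.
move=> k0 y m e e0; have e2 : 0 < e / 2 by rewrite divr_gt0.
have [j _ near_y] := denseD y m 0 e2.
have [L HL] := geometric_small archK (ler0n K 3) e2.
have [l lel cl] := cP (k0, j) (maxn k0 (maxn m L)).
move: lel; rewrite !geq_max => /and3P[lek lem /HL small].
exists (N l.+1) => k; have := close l k; rewrite cl => /(_ lek) => le1.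
apply: le_lt_trans (sn_tri (gsn gp m) (if k == k0 then d j else 0) _ _) _.
rewrite [e](_ : _ = e / 2 + e / 2); last by field.
rewrite ltrD //; first by rewrite (le_lt_trans _ small) // (le_trans (gsn_mono gp _ lem)).
by case: eqP => // _; rewrite subrr (sn0 (gsn gp m)).
Qed.

End UniversalVectors.

(** * The identity plus a backward shift *)

Section WideSeminorm.
Variables (K : numFieldType) (X : lmodType K) (p : nat -> X -> K).
Hypothesis archK : archimedean K.
Hypothesis gp : graded_seminorms p.
Hypothesis cp : seq_complete p.
Variable a : nat.
Variables (D : nat -> X) (g : nat -> {scalar X}).
Hypothesis denseD : approximating p D.
Hypothesis bounded_g : forall j, bounded_form p (g j).
Hypothesis total_g : forall x, (forall j, g j x = 0) -> x = 0.
Variables (x : nat -> X) (f : nat -> {scalar X}).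
Hypothesis adapted_xf : forall n, adapted p a D g x f n (x n) (f n).

Let f_x i j : f i (x j) = (i == j)%:R.
Proof.
apply: (@dual_extension_biorthogonal _ _ x f (maxn i j).+1); rewrite ?ltnS ?leq_maxl ?leq_maxr //.
by move=> k _; case: (adapted_xf k).
Qed.

Let f_le n v : `|f n v| <= 2^-1 ^+ n.+1 * p a v.
Proof. by have [_ + _ _ _] := adapted_xf n; apply. Qed.

Let f_le1 n v : `|f n v| <= p a v.
Proof.
apply: le_trans (f_le n v) _; rewrite ler_piMl ?(sn_ge0 (gsn gp a)) //.
by rewrite -(expr0 (2^-1)) geom_le.
Qed.

Let bounded_f n : bounded_form p (f n).
Proof. by exists a, 1; split=> // v; rewrite mul1r. Qed.

(** The series moves coordinate [2n + 1] to coordinate [n]. It annihilates all [x_(2n)]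
    and still has arbitrarily long chains above every [x_n]. *)
Lemma shift_exists : exists S : {linear X -> X}, bounded_operator p S /\
  forall v, tends p (fun N => \sum_(n < N) f n.*2.+1 v *: x n) (S v).
Proof.
apply: (operator_series (f := fun n => f n.*2.+1) archK gp cp (a := a)) => n v //.
have [_ _ small _ _] := adapted_xf n.*2.+1.
have ltn : (n < n.*2.+1)%N by rewrite ltnS -addnn leq_addr.
apply: le_trans (_ : `|f n.*2.+1 v| * p n.*2.+1 (x n) <= _).
  by rewrite ler_wpM2l // gsn_mono // ltnW.
by apply: le_trans (small _ _ ltn) _; rewrite ler_wpM2r ?(sn_ge0 (gsn gp a)) // geom_le // ltnW.
Qed.

Definition in_span v := forall Q : X -> Prop,
  Q 0 -> (forall c u w, Q u -> Q w -> Q (c *: u + w)) -> (forall i, Q (x i)) -> Q v.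

Lemma in_span_sum n (c : nat -> K) : in_span (\sum_(i < n) c i *: x i).
Proof. by move=> Q Q0 linQ Qx; elim/big_rec: _ => // i v _ Qv; exact: linQ. Qed.

Lemma in_span_linear c u w : in_span u -> in_span w -> in_span (c *: u + w).
Proof. by move=> su sw Q Q0 linQ Qx; exact: (linQ _ _ _ (su Q Q0 linQ Qx) (sw Q Q0 linQ Qx)). Qed.

Lemma in_span_dense : exists d : nat -> X, approximating p d /\ forall l, in_span (d l).
Proof.
have /choice[d dP] l : exists v, in_span v /\ p l (v - D l) <= 2^-1 ^+ l.
  have [_ _ _ _ /(_ _)[|c [b le_l]]] := adapted_xf l.*2.+1; first by rewrite /= odd_double.
  have half : (l.*2.+1)./2 = l by rewrite -add1n halfD odd_double /= add0n doubleK.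
  rewrite half in le_l.
  exists (\sum_(i < l.*2.+1) c i *: x i + b *: x l.*2.+1); split=> //.
  rewrite addrC; apply: in_span_linear; last exact: in_span_sum.
  by move=> Q _ _; apply.
exists d; split=> [y m e N e0|l]; last by have [] := dP l.
have e2 : 0 < e / 2 by rewrite divr_gt0.
have [L HL] := geometric_small archK ler01 e2.
have [l lel near_y] := denseD y m (maxn N (maxn m L)) e2.
move: lel; rewrite !geq_max => /and3P[leNl leml /HL]; rewrite mul1r => small.
exists l => //; apply: le_lt_trans (sn_tri (gsn gp m) (D l) _ _) _.
rewrite [e](_ : _ = e / 2 + e / 2); last by field.
rewrite ltrD // (le_lt_trans _ small) // (le_trans (gsn_mono gp _ leml)) //.
by have [_] := dP l.
Qed.

Variable S : {linear X -> X}.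
Hypothesis bounded_S : bounded_operator p S.
Hypothesis S_series : forall v, tends p (fun N => \sum_(n < N) f n.*2.+1 v *: x n) (S v).

Let S_odd0 v : (forall n, f n.*2.+1 v = 0) -> S v = 0.
Proof.
move=> f0; apply: (tends_unique gp (S_series v)).
apply: (tends_eq_from (N := 0)) (tends_cst gp 0) => N _.
by rewrite big1 // => n _; rewrite f0 scale0r.
Qed.

Let S_even n : S (x n.*2) = 0.
Proof.
by apply: S_odd0 => m; rewrite f_x; case: eqP => // E; have := congr1 odd E; rewrite /= !odd_double.
Qed.

Let S_odd n : S (x n.*2.+1) = x n.
Proof.
apply: (tends_unique gp (S_series _)).
apply: (tends_eq_from (N := n.+1)) (tends_cst gp (x n)) => N ltnN.
rewrite (bigD1 (Ordinal ltnN)) //= f_x eqxx scale1r big1 ?addr0 // => m nmn.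
rewrite f_x eqSS (inj_eq double_inj); move: nmn.
by rewrite -(inj_eq val_inj) => /negPf ->; rewrite scale0r.
Qed.

Let linT : linear (fun v => v + S v).
Proof. by move=> c u v; rewrite linearP scalerDr addrACA. Qed.

Definition id_plus_shift : {linear X -> X} := pack_operator linT.
Local Notation T := id_plus_shift.

Lemma bounded_id_plus_shift : bounded_operator p T.
Proof.
move=> m; have [m' [C [C0 bC]]] := bounded_S m; exists (maxn m m'), (1 + C).
split=> [|v]; first exact: addr_ge0.
apply: le_trans (snD (gsn gp m) _ _) _; rewrite mulrDl mul1r lerD //.
  by rewrite gsn_mono // leq_maxl.
by rewrite (le_trans (bC v)) // ler_wpM2l // gsn_mono // leq_maxr.
Qed.

(** The displacements allowed when steering: they leave the coordinates [f_(2i)] alone. *)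
Definition even_null v := in_span v /\ forall i, f i.*2 v = 0.

Lemma even_null_linear c u w : even_null u -> even_null w -> even_null (c *: u + w).
Proof.
move=> [su fu] [sw fw]; split=> [|i]; first exact: in_span_linear.
by rewrite linearP /= fu fw mulr0 addr0.
Qed.

Lemma double_chain i : exists m j, i = iter j (fun n => n.*2.+1) m.*2.
Proof.
have [n] := ubnP i; elim: n i => // n IHn i lti.
case oddi : (odd i); last by exists i./2, 0%N; rewrite /= -[LHS]odd_double_half oddi.
have [|m [j Ej]] := IHn i./2.
  by have := odd_double_half i; rewrite oddi; lia.
by exists m, j.+1; rewrite iterS -Ej -[LHS]odd_double_half oddi.
Qed.

Lemma steer_span u v : in_span u -> in_span v -> steerable p T even_null u v.
Proof.
have st w : in_span w -> steerable p T even_null w 0 /\ steerable p T even_null 0 w.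
  have null0 : even_null 0 by split=> [Q|i]; rewrite ?linear0.
  move=> /(_ (fun w => steerable p T even_null w 0 /\ steerable p T even_null 0 w)).
  apply=> [|c w1 w2 [away1 to1] [away2 to2]|i].
  - suff st0 : steerable p T even_null 0 0 by [].
    exists (fun=> 0); split=> [n||]; [by rewrite subrr | exact: tends_cst |].
    by under eq_fun do rewrite iter_linear0; exact: tends_cst.
  - split.
      by have := steerable_linear gp even_null_linear c away1 away2; rewrite scaler0 addr0.
    by have := steerable_linear gp even_null_linear c to1 to2; rewrite scaler0 addr0.
  have [m [j ->]] := double_chain i; pose y j := x (iter j (fun n => n.*2.+1) m.*2).
  apply: (steerable_chain archK gp (y := y)) => [|||k].
  - by rewrite /= /y /= S_even addr0.
  - by move=> k; rewrite /= /y iterS S_odd.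
  - exact: even_null_linear.
  split=> [Q _ _|l]; first exact.
  by rewrite f_x iterS; case: eqP => // E; have := congr1 odd E; rewrite /= !odd_double.
move=> /st[awayu _] /st[_ tov].
by have := steerable_linear gp even_null_linear 1 awayu tov; rewrite !scale1r addr0 add0r.
Qed.

Lemma id_plus_shift_mixing u v m (e : K) : 0 < e -> exists N : nat, forall n, (N <= n)%N ->
  exists w, p m (w - u) < e /\ p m (iter n T w - v) < e.
Proof.
move=> e0; have [d [dd sd]] := in_span_dense.
have e2 : 0 < e / 2 by rewrite divr_gt0.
have [i _ near_u] := dd u m _ 0%N e2; have [j _ near_v] := dd v m _ 0%N e2.
have [w [_ wi wj]] := steer_span (sd i) (sd j).
have [N1 HN1] := wi m _ e2; have [N2 HN2] := wj m _ e2.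
exists (maxn N1 N2) => n; rewrite geq_max => /andP[/HN1 lt1 /HN2 lt2].
exists (w n); rewrite [e](_ : _ = e / 2 + e / 2); last by field.
by split; [apply: le_lt_trans (sn_tri (gsn gp m) (d i) _ _) _
          | apply: le_lt_trans (sn_tri (gsn gp m) (d j) _ _) _]; rewrite ltrD.
Qed.


Variable zeta : nat -> X.
Hypothesis zeta_null : forall k i, f i.*2 (zeta k) = 0.
Hypothesis zeta_small : forall k, p k (zeta k) <= 2 * 2^-1 ^+ k.
Hypothesis zeta_universal : forall k0 y m (e : K), 0 < e -> exists n, forall k,
  p m (iter n T (zeta k) - (if k == k0 then y else 0)) < e.

(** The operator is to be added to the identity on a space of fixed vectors of the shift
    operator: the added part has a rich orbit. *)
Lemma lift_exists : exists Z : {linear X -> X}, bounded_operator p Z /\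
  forall v, tends p (fun N => \sum_(n < N) f n.*2 v *: zeta n) (Z v).
Proof.
apply: (operator_series (f := fun n => f n.*2) archK gp cp (a := a)) => n v //.
apply: le_trans (_ : 2^-1 ^+ n.*2.+1 * p a v * (2 * 2^-1 ^+ n) <= _).
  by rewrite ler_pM // ?f_le // (sn_ge0 (gsn gp n)).
rewrite [leLHS](_ : _ = 2^-1 ^+ n.*2 * (2^-1 ^+ n * p a v)); last first.
  by rewrite exprS; field.
by rewrite ler_piMl ?mulr_ge0 ?geom_ge0 ?(sn_ge0 (gsn gp a)) // -(expr0 (2^-1)) geom_le.
Qed.

Variable Z : {linear X -> X}.
Hypothesis bounded_Z : bounded_operator p Z.
Hypothesis Z_series : forall v, tends p (fun N => \sum_(n < N) f n.*2 v *: zeta n) (Z v).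

Let f_Z i v : f i.*2 (Z v) = 0.
Proof.
apply: (tends_form (N := 0) gp (bounded_f _) (Z_series v)) => N _.
by rewrite linear_sum big1 // => n _; rewrite linearZ /= zeta_null mulr0.
Qed.

Let Z_null v : (forall i, f i.*2 v = 0) -> Z v = 0.
Proof.
move=> f0; apply: (tends_unique gp (Z_series v)).
apply: (tends_eq_from (N := 0)) (tends_cst gp 0) => N _.
by rewrite big1 // => n _; rewrite f0 scale0r.
Qed.

Let ZZ v : Z (Z v) = 0.
Proof. by apply: Z_null => i. Qed.

(** Vectors expanding along the [x_(2i)]. The conditions on [g] replace convergence of the
    expansion: they hold at each [x_(2k)], define a closed subspace, and leave only 0 when all
    even coordinates vanish. *)
Definition even_coordinates v :=
  (forall n, f n.*2.+1 v = 0) /\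
  forall n j, (j < n)%N -> g j (residual (fun i => f i.*2) (fun i => x i.*2) n v) = 0.

(** The image of [even_coordinates] under [1 + Z], whose inverse is [1 - Z] because
    [Z^2 = 0]. Written as a preimage it is visibly closed. *)
Definition graph_subspace v := even_coordinates (id_sub Z v).

Lemma even_coordinates_linear c u v :
  even_coordinates u -> even_coordinates v -> even_coordinates (c *: u + v).
Proof.
move=> [fu gu] [fv gv]; split=> [n|n j ltj].
  by rewrite linearP /= fu fv mulr0 addr0.
by rewrite linearP linearP gu // gv // mulr0 addr0.
Qed.

Let even_coordinates_x k : even_coordinates (x k.*2).
Proof.
split=> [n|n j ltj].
  by rewrite f_x; case: eqP => // E; have := congr1 odd E; rewrite /= !odd_double.
have [ltkn|lenk] := ltnP k n.
  rewrite (residual_root (x := fun i => x i.*2) _ ltkn) ?linear0 // => i l _ _.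
  by rewrite f_x (inj_eq double_inj).
rewrite residual_fixed => [|i lti]; last first.
  by rewrite f_x (inj_eq double_inj) ltn_eqF // (leq_trans lti).
have [_ _ _ even_g _] := adapted_xf k.*2; apply: even_g; first by rewrite odd_double.
by rewrite -addnn (leq_trans (leq_trans ltj lenk)) // leq_addr.
Qed.

Let even_coordinates_total v : even_coordinates v -> (forall k, f k.*2 v = 0) -> v = 0.
Proof.
move=> [_ gv] fv; apply: total_g => j; have := gv j.+1 j (ltnSn j).
by rewrite residual_fixed.
Qed.

Lemma graph_subspace_closed v : (forall m (e : K), 0 < e ->
  exists2 y, graph_subspace y & p m (y - v) < e) -> graph_subspace v.
Proof.
move=> near_v.
have bQ : bounded_operator p (id_sub Z) by exact: bounded_id_sub.
split=> [n|n j ltj].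
  apply: (form_closed gp (bounded_f _) bQ) => m e /(near_v m).
  by case=> y [fy _] lt_e; exists y.
pose P := residual (fun i => f i.*2) (fun i => x i.*2) n.
have bR : bounded_operator p (P \o id_sub Z).
  by apply: bounded_comp bQ; exact: bounded_residual.
apply: (form_closed gp (L := P \o id_sub Z) (bounded_g j) bR) => m e /(near_v m).
by case=> y [_ gy] lt_e; exists y => //; exact: gy.
Qed.

(** The component [v' = v - Z v] is fixed by all iterates, so approximating [y] amounts to
    bringing the iterate of [Z v] close to [y - v']. *)
Lemma graph_subspace_hypercyclic v : graph_subspace v -> v != 0 ->
  approximable p (fun y => exists n, y = iter n T v).
Proof.
move=> Mv v0; pose v' := v - Z v; have {}Mv : even_coordinates v' := Mv.
have Tv' n : iter n T v' = v'.
  elim: n => [//|n IHn]; rewrite iterS IHn /= S_odd0 ?addr0 //.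
  by case: Mv.
have [k0 fk0] : exists k0, f k0.*2 v != 0.
  apply: contrapT => no; have fv k : f k.*2 v = 0.
    by apply/eqP; apply: contrapT => /negP nz; apply: no; exists k.
  have Ev : v = v' by rewrite /v' Z_null ?subr0.
  by move/eqP: v0; apply; rewrite Ev; apply: even_coordinates_total => // k; rewrite -Ev.
move=> y m e e0; pose c := f k0.*2 v.
pose e' := e / (2 * p a v + 1).
have pa0 : 0 < 2 * p a v + 1 by rewrite ltr_wpDl // mulr_ge0 // (sn_ge0 (gsn gp a)).
have e'0 : 0 < e' by rewrite divr_gt0.
have [n nP] := zeta_universal k0 (c^-1 *: (y - v')) m e'0.
exists (iter n T v); first by exists n.
have -> : iter n T v - y = iter n T (Z v) - (y - v').
  have Ev : v = 1 *: v' + Z v by rewrite scale1r subrK.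
  by rewrite {1}Ev iter_linear scale1r Tv' opprB addrA [v' + _]addrC.
apply: le_lt_trans (_ : 2 * p a v * e' < e); last first.
  by rewrite /e' mulrCA gtr_pMr // ltr_pdivrMr // mul1r ltrDl.
pose Tn := pack_operator (iter_linear T n).
have bTn : bounded_operator p Tn by apply: bounded_iter; exact: bounded_id_plus_shift.
apply: (tends_le gp (N := k0.+1) (tends_operator gp bTn (Z_series v))) => N ltN.
rewrite [_ N](_ : _ = \sum_(k < N) f k.*2 v *: Tn (zeta k)); last first.
  by rewrite /comp linear_sum; apply: eq_bigr => k _; rewrite linearZ.
pose tgt k := if k == k0 then c^-1 *: (y - v') else 0.
have -> : y - v' = \sum_(k < N) f k.*2 v *: tgt k.
  rewrite (bigD1 (Ordinal ltN)) //= /tgt eqxx scalerA mulfV // scale1r big1 ?addr0 // => k.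
  by rewrite -(inj_eq val_inj) /= => /negPf ->; rewrite scaler0.
rewrite -sumrB.
apply: le_trans (sn_sum (gsn gp m) _ _) _.
apply: le_trans (_ : \sum_(k < N) 2^-1 ^+ k * (p a v * e') <= _).
  apply: ler_sum => k _; rewrite -scalerBr (snZ (gsn gp m)) mulrA.
  apply: ler_pM => //; [exact: sn_ge0 (gsn gp m) _ | | exact: ltW (nP k)].
  apply: le_trans (f_le _ _) _; rewrite ler_wpM2r ?(sn_ge0 (gsn gp a)) // geom_le //.
  by rewrite -addnn ltnW // ltnS leq_addr.
rewrite -mulr_suml -mulrA ler_wpM2r // ?sum_geom_le // mulr_ge0 ?(ltW e'0) //.
exact: sn_ge0 (gsn gp a) _.
Qed.

Lemma graph_subspace_basis : exists (b : nat -> X) (h : nat -> {scalar X}),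
  (forall i, graph_subspace (b i)) /\ forall i j, h i (b j) = (i == j)%:R.
Proof.
exists (fun k => x k.*2 + Z (x k.*2)), (fun i => f i.*2); split=> [i|i j].
  by rewrite /graph_subspace /= linearD ZZ addr0 addrK; exact: even_coordinates_x.
by rewrite linearD /= f_Z addr0 f_x (inj_eq double_inj).
Qed.

End WideSeminorm.

Theorem wide_seminorm_case (K : numFieldType) (X : lmodType K) (p : nat -> X -> K) a
    (D : nat -> X) :
  archimedean K -> graded_seminorms p -> seq_complete p -> has_norming_forms X ->
  approximating p D ->
  (forall n (f : nat -> {scalar X}), (forall i, bounded_form p (f i)) ->
     exists2 x, (forall i, (i < n)%N -> f i x = 0) & p a x != 0) ->
  mixing_with_hypercyclic_subspace p.
Proof.
move=> archK gp cp normX denseD wide.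
have [g [bg tg]] := total_forms gp normX denseD.
have [x [f ad]] := adapted_system gp normX wide D bg.
have [S [bS Ss]] := shift_exists archK gp cp ad.
have [d [dd sd]] := in_span_dense archK gp denseD ad.
have [||zeta [z0 zs zu]] := universal_vectors archK gp cp (bounded_id_plus_shift gp bS)
  (@even_null_linear _ _ x f) _ dd.
- by split=> [Q|i]; rewrite ?linear0.
- move=> u l [su _]; split; apply: (steer_span archK gp ad Ss) => //.
have zf k i : f i.*2 (zeta k) = 0.
  apply: z0; last by move=> v [].
  have [_ f_le _ _ _] := ad i.*2; exists a, (2^-1 ^+ i.*2.+1); split=> //.
  exact: geom_ge0.
have [Z [bZ Zs]] := lift_exists archK gp cp ad zs.
exists (id_plus_shift S); split.
- exact: bounded_id_plus_shift.
- exact: (id_plus_shift_mixing archK gp denseD ad Ss).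
exists (graph_subspace g x f Z); split.
- exact: (graph_subspace_closed gp bg ad).
- split; first by split=> [n|n j _]; rewrite !linear0.
  by move=> c u v Mu Mv; rewrite /graph_subspace linearP; exact: even_coordinates_linear.
- exact: (graph_subspace_basis gp ad zf).
exact: (graph_subspace_hypercyclic gp tg ad bS Ss zu Zs).
Qed.

(** * Spaces whose seminorms are controlled by finitely many functionals *)

Section CoordinateSystem.
Variables (K : numFieldType) (X : lmodType K) (p : nat -> X -> K).
Hypothesis gp : graded_seminorms p.
Hypothesis dimX : ~ finite_dimensional (@setT X).
Hypothesis narrow : forall a, exists n (f : nat -> {scalar X}),
  (forall i, bounded_form p (f i)) /\
  forall x, (forall i, (i < n)%N -> f i x = 0) -> p a x = 0.

(** Countably many finite families of functionals, listed in one sequence. *)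
Lemma controlling_sequence : exists psi : nat -> {scalar X},
  (forall l, bounded_form p (psi l)) /\
  forall a, exists N : nat, forall x, (forall l, (l < N)%N -> psi l x = 0) -> p a x = 0.
Proof.
have /choice[n /choice[f fP]] := narrow.
pose ai l : nat * nat := odflt (0, 0)%N (unpickle l).
exists (fun l => f (ai l).1 (ai l).2); split=> [l|a]; first by have [] := fP (ai l).1.
exists (\max_(i < n a) (pickle (a, nat_of_ord i)).+1) => x psi0.
have [_] := fP a; apply => i lti.
have := psi0 (pickle (a, i)); rewrite /ai pickleK /=; apply.
exact: (leq_bigmax (Ordinal lti)).
Qed.

Variable psi : nat -> {scalar X}.
Hypothesis bounded_psi : forall l, bounded_form p (psi l).
Hypothesis psi_control : forall a, exists N : nat,
  forall x, (forall l, (l < N)%N -> psi l x = 0) -> p a x = 0.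

(** The last condition ensures that the coordinates control the sequence [psi], and through
    it all seminorms. *)
Definition coordinate (xs : nat -> X) (fs : nat -> {scalar X}) n (x : X) (f : {scalar X}) :=
  [/\ dual_extension xs fs n x f, bounded_form p f
    & forall v, (forall i, (i < n)%N -> fs i v = 0) -> f v = 0 -> psi n v = 0].

Lemma coordinate_step xs fs n :
  (forall i, (i < n)%N -> coordinate xs fs i (xs i) (fs i)) ->
  exists x f, coordinate xs fs n x f.
Proof.
move=> co.
have bio i j : (i < n)%N -> (j < n)%N -> fs i (xs j) = (i == j)%:R.
  by apply: dual_extension_biorthogonal => k /co[].
(* If [psi n] is already controlled, any functional of the sequence that is not zero on
   the joint kernel will do; the latter is nonzero as [X] has infinite dimension. *)
have [x [j [fsx psijx psin]]] : exists x j, [/\ forall i, (i < n)%N -> fs i x = 0,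
    psi j x != 0
  & j = n \/ forall v, (forall i, (i < n)%N -> fs i v = 0) -> psi n v = 0].
  have [psin0|] :=
    pselect (forall v, (forall i, (i < n)%N -> fs i v = 0) -> psi n v = 0); last first.
    move=> /existsNP[x /not_implyP[fsx psix]]; exists x, n; split=> //; last by left.
    by apply/eqP.
  have [x [fsx x0]] : exists x, (forall i, (i < n)%N -> fs i x = 0) /\ x != 0.
    apply: contrapT => no; apply: dimX.
    exists n, (fun i => xs i); split=> // v _; exists (fun i => fs i v).
    apply/eqP; rewrite -subr_eq0; apply: contrapT => /negP nz; apply: no.
    by exists (residual fs xs n v); split=> // i lti; exact: residual_null.
  have [j psijx] : exists j, psi j x != 0.
    apply: contrapT => no; move/eqP: x0; apply; case: gp => _ _; apply=> a.
    have [N] := psi_control a; apply=> l _; apply/eqP; apply: contrapT => /negP nz.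
    by apply: no; exists l.
  by exists x, j; split=> //; right.
have bres : bounded_operator p (residual fs xs n).
  by apply: bounded_residual => // i lti; have [] := co _ lti.
pose k : {scalar X} := psi j \o residual fs xs n.
have k_root i : (i < n)%N -> k (xs i) = 0.
  by move=> lti; rewrite -(linear0 (psi j)) -(residual_root bio lti).
have k_fixed v : (forall i, (i < n)%N -> fs i v = 0) -> k v = psi j v.
  by move=> fsv; rewrite -{2}(residual_fixed xs fsv).
exists x, (scale_form (psi j x)^-1 k); split.
- split=> // [|i lti]; first by rewrite scale_formE k_fixed // mulVf.
  by rewrite scale_formE k_root ?mulr0.
- by apply: bounded_scale_form; apply: bounded_form_comp bres.
move=> v fsv; case: psin => [<-|psin0 _]; last exact: psin0.
by rewrite scale_formE k_fixed // => /eqP; rewrite mulf_eq0 invr_eq0 (negPf psijx) => /eqP.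
Qed.

Lemma coordinate_system : exists (x : nat -> X) (f : nat -> {scalar X}),
  [/\ forall i j, f i (x j) = (i == j)%:R, forall i, bounded_form p (f i)
    & forall a, exists N : nat, forall v, (forall i, (i < N)%N -> f i v = 0) -> p a v = 0].
Proof.
pose A := (X * {scalar X})%type; have A0 : A by exact: (0, psi 0).
pose P (s : seq A) (y : A) :=
  coordinate (fun i => (nth A0 s i).1) (fun i => (nth A0 s i).2) (size s) y.1 y.2.
have ext xs fs xs' fs' n x f :
    (forall i, (i < n)%N -> xs i = xs' i) -> (forall i, (i < n)%N -> fs i = fs' i) ->
    coordinate xs fs n x f -> coordinate xs' fs' n x f.
  move=> Ex Ef [dual bf ctl]; split=> //; first exact: dual_extension_ext dual.
  by move=> v fv; apply: ctl => i lti; rewrite Ef ?fv.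
have [s co|u uP] := @sequential_choice A A0 P.
  have [|x [f xf]] := @coordinate_step (fun i => (nth A0 s i).1) (fun i => (nth A0 s i).2) (size s).
    move=> i lti; have := co i lti; rewrite /P size_takel ?(ltnW lti) //.
    by apply: ext => j ltj; rewrite nth_take.
  by exists (x, f).
exists (fun n => (u n).1), (fun n => (u n).2).
have co n : coordinate (fun n => (u n).1) (fun n => (u n).2) n (u n).1 (u n).2.
  have := uP n; rewrite /P size_mkseq; apply: ext => i lti; rewrite nth_mkseq //.
split=> [i j|i|a]; last 1 first.
- have [N NP] := psi_control a; exists N => v fv; apply: NP => l ltl.
have [_ _] := co l; apply=> [i lti|]; apply: fv => //.
  exact: ltn_trans lti ltl.
- apply: (@dual_extension_biorthogonal _ _ (fun n => (u n).1) (fun n => (u n).2)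
    (maxn i j).+1); rewrite ?ltnS ?leq_maxl ?leq_maxr //.
  by move=> k _; case: (co k).
by have [] := co i.
Qed.

End CoordinateSystem.

(** * The backward shift on all scalar sequences *)

Section BackwardShift.
Variables (K : numFieldType) (X : lmodType K) (p : nat -> X -> K).
Hypothesis gp : graded_seminorms p.
Hypothesis cp : seq_complete p.
Variables (D : nat -> X) (x : nat -> X) (f : nat -> {scalar X}).
Hypothesis denseD : approximating p D.
Hypothesis f_x : forall i j, f i (x j) = (i == j)%:R.
Hypothesis bounded_f : forall i, bounded_form p (f i).
Hypothesis control : forall a, exists N : nat,
  forall v, (forall i, (i < N)%N -> f i v = 0) -> p a v = 0.

Let f_inj v w : (forall i, f i v = f i w) -> v = w.
Proof.
move=> fvw; apply/eqP; rewrite -subr_eq0; apply/eqP; case: gp => _ _; apply=> a.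
by have [N] := control a; apply=> i _; rewrite linearB /= fvw subrr.
Qed.

(** Each seminorm depends on finitely many coordinates, so any series along the [x_i] is
    Cauchy: [X] is the space of all scalar sequences. *)
Lemma prescribed_coordinates (c : nat -> K) : exists v, forall i, f i v = c i.
Proof.
pose u n := \sum_(i < n) c i *: x i.
have fu k n : (k < n)%N -> f k (u n) = c k by move=> ltk; exact: form_combination.
have [|v uv] := cp (u := u).
  move=> m e e0; have [N NP] := control m; exists N => i j lei lej.
  rewrite NP // => k ltk; rewrite linearB /= !fu ?subrr //; exact: leq_trans ltk _.
by exists v => i; apply: (tends_form (N := i.+1) gp (bounded_f i) uv) => n; exact: fu.
Qed.

Lemma backward_shift_exists : exists T : {linear X -> X}, forall i v, f i (T v) = f i.+1 v.
Proof.
have /choice[T TP] v : exists w, forall i, f i w = f i.+1 v by exact: prescribed_coordinates.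
have linT : linear T.
  by move=> a u v; apply: f_inj => i; rewrite linearP /= !TP linearP.
by exists (pack_operator linT).
Qed.

Variable T : {linear X -> X}.
Hypothesis f_T : forall i v, f i (T v) = f i.+1 v.

Let f_iter n i v : f i (iter n T v) = f (n + i)%N v.
Proof. by elim: n i => [//|n IHn] i; rewrite iterS f_T IHn addnS. Qed.

Lemma backward_shift_bounded : bounded_operator p T.
Proof.
move=> m; have [N NP] := control m.
pose P := finite_rank (fun i => f i.+1) x N.
have [m' [C [C0 bC]]] : exists m' (C : K), 0 <= C /\ forall v, p m (P v) <= C * p m' v.
  by apply: bounded_finite_rank => // i _; exact: bounded_f.
exists m', C; split=> // v; apply: le_trans (bC v).
have pz : p m (T v - P v) = 0.
  apply: NP => k ltk; rewrite linearB /= f_T.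
  by rewrite (form_combination (fun i j _ _ => f_x i j) (fun i => f i.+1 v)) ?subrr.
have := snD (gsn gp m) (T v - P v) (P v).
by rewrite subrK pz add0r.
Qed.

(** A sequence beginning like [u] and continuing, from index [n] on, with [v]. *)
Lemma backward_shift_mixing u v m (e : K) : 0 < e -> exists N : nat, forall n, (N <= n)%N ->
  exists w, p m (w - u) < e /\ p m (iter n T w - v) < e.
Proof.
move=> e0; have [N NP] := control m; exists N => n leNn.
have [w fw] := prescribed_coordinates (fun i => if (i < n)%N then f i u else f (i - n)%N v).
exists w; split; rewrite NP // => i lti; rewrite linearB /=.
  by rewrite fw (leq_trans lti leNn) subrr.
by rewrite f_iter fw ltnNge leq_addr /= addKn subrr.
Qed.

(** The block [l] consists of the indices from [2^l] to [2^(l+1) - 1]. It belongs to the owner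
    [(c l).1], and the template spells there the first coordinates of [D (c l).2]. The
    index 0 is treated as the index 1. *)
Variable c : nat -> nat * nat.
Hypothesis c_recurrent : forall kj N, exists2 l, (N <= l)%N & c l = kj.

Definition owner n := (c (trunc_log 2 n)).1.
Definition template n := f (n - 2 ^ trunc_log 2 n) (D (c (trunc_log 2 n)).2).

(** The coordinates along the blocks of each owner are proportional to the template. Cross
    multiplication makes the condition linear and closed. *)
Definition template_subspace v :=
  forall n n', owner n = owner n' -> f n v * template n' = f n' v * template n.

Let block_log l i : (i < 2 ^ l)%N -> trunc_log 2 (2 ^ l + i) = l.
Proof.
move=> lti; apply: trunc_log_eq => //.
by rewrite leq_addr /= expnS mul2n -addnn ltn_add2l.
Qed.

Let owner_block l i : (i < 2 ^ l)%N -> owner (2 ^ l + i) = (c l).1.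
Proof. by move=> lti; rewrite /owner block_log. Qed.

Let template_block l i : (i < 2 ^ l)%N -> template (2 ^ l + i) = f i (D (c l).2).
Proof. by move=> lti; rewrite /template block_log // addKn. Qed.

Lemma template_neq0 k : exists n, owner n = k /\ template n != 0.
Proof.
have [j Dj] : exists j, f 0%N (D j) != 0.
  apply: contrapT => no.
  have := form_closed gp (L := idfun) (x := x 0) (bounded_f 0) (bounded_idfun p).
  rewrite /= f_x eqxx => H; have /eqP : (1 : K) = 0; last by rewrite oner_eq0.
  apply: H => m e e0; have [j _ ltj] := denseD (x 0%N) m 0%N e0.
  by exists (D j) => //; apply/eqP; apply: contrapT => /negP nz; apply: no; exists j.
have [l _ cl] := c_recurrent (k, j) 0.
exists (2 ^ l + 0)%N; rewrite owner_block ?template_block ?expn_gt0 // cl.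
by split.
Qed.

Lemma template_subspace_closed v : (forall m (e : K), 0 < e ->
  exists2 y, template_subspace y & p m (y - v) < e) -> template_subspace v.
Proof.
move=> near_v n n' Enn'; apply/eqP; rewrite -subr_eq0; apply/eqP.
have lin_h : scalar (fun v => f n v * template n' - f n' v * template n).
  by move=> a u w; rewrite !linearP /=; ring.
have bh : bounded_form p (pack_form lin_h).
  have [m1 [C1 [C10 b1]]] := bounded_f n; have [m2 [C2 [C20 b2]]] := bounded_f n'.
  exists (maxn m1 m2), (C1 * `|template n'| + C2 * `|template n|).
  split=> [|w]; first by rewrite addr_ge0 ?mulr_ge0.
  apply: le_trans (ler_normB _ _) _; rewrite !normrM mulrDl lerD // mulrAC ler_wpM2r //.
    by rewrite (le_trans (b1 w)) // ler_wpM2l // gsn_mono // leq_maxl.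
  by rewrite (le_trans (b2 w)) // ler_wpM2l // gsn_mono // leq_maxr.
apply: (form_closed gp (L := idfun) bh (bounded_idfun p)) => m e /(near_v m)[y My lty].
by exists y => //=; rewrite My // subrr.
Qed.

Lemma template_subspace_hypercyclic v : template_subspace v -> v != 0 ->
  approximable p (fun y => exists n, y = iter n T v).
Proof.
move=> Mv v0 y m e e0.
have [n0 fn0] : exists n, f n v != 0.
  apply: contrapT => no; move/eqP: v0; apply; apply: f_inj => i; rewrite linear0.
  by apply/eqP; apply: contrapT => /negP nz; apply: no; exists i.
have [n1 [own1 tn1]] := template_neq0 (owner n0).
pose b := f n1 v / template n1.
have fE n : owner n = owner n0 -> f n v = b * template n.
  by move=> own; rewrite /b mulrAC -Mv ?own ?own1 // mulfK.
have b0 : b != 0 by apply: contraNneq fn0 => b0; rewrite fE // b0 mul0r.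
have nb0 : 0 < `|b| by rewrite normr_gt0.
have [j _ near_y] := denseD (b^-1 *: y) m 0%N (divr_gt0 e0 nb0).
have [N NP] := control m; have [l leNl cl] := c_recurrent (owner n0, j) N.
exists (iter (2 ^ l) T v); first by exists (2 ^ l)%N.
have pz : p m (iter (2 ^ l) T v - b *: D j) = 0.
  apply: NP => i lti; have lti2 : (i < 2 ^ l)%N.
    by rewrite (leq_trans lti) // (leq_trans leNl) // ltnW // ltn_expl.
  rewrite linearB linearZ /= f_iter fE ?owner_block ?template_block ?cl //=.
  by rewrite subrr.
apply: le_lt_trans (sn_tri (gsn gp m) (b *: D j) _ _) _; rewrite pz add0r.
rewrite -[y in X in _ - X](scalerKV b0) -scalerBr (snZ (gsn gp m)) mulrC.
by rewrite -ltr_pdivlMr.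
Qed.

Lemma template_subspace_basis : exists (b : nat -> X) (h : nat -> {scalar X}),
  (forall i, template_subspace (b i)) /\ forall i j, h i (b j) = (i == j)%:R.
Proof.
have /choice[n nP] := template_neq0.
have /choice[b bP] k := prescribed_coordinates (fun i => if owner i == k then template i else 0).
exists b, (fun i => scale_form (template (n i))^-1 (f (n i))); split=> [k i j own|i j /=].
  by rewrite !bP own; case: eqP => _; rewrite ?mul0r // mulrC.
have [own tn] := nP i; rewrite bP own; case: eqP => _; first by rewrite mulVf.
by rewrite mulr0.
Qed.

End BackwardShift.

Theorem narrow_seminorms_case (K : numFieldType) (X : lmodType K) (p : nat -> X -> K)
    (D : nat -> X) :
  graded_seminorms p -> seq_complete p -> approximating p D ->
  ~ finite_dimensional (@setT X) ->
  (forall a, exists n (f : nat -> {scalar X}), (forall i, bounded_form p (f i)) /\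
     forall x, (forall i, (i < n)%N -> f i x = 0) -> p a x = 0) ->
  mixing_with_hypercyclic_subspace p.
Proof.
move=> gp cp denseD dimX narrow.
have [psi [bpsi psi_control]] := controlling_sequence narrow.
have [x [f [f_x bf control]]] := coordinate_system gp dimX bpsi psi_control.
have [T f_T] := backward_shift_exists gp cp f_x bf control.
have [c c_rec] := recurrent_enumeration (0, 0)%N.
exists T; split.
- exact: (backward_shift_bounded gp f_x bf control f_T).
- exact: (backward_shift_mixing gp cp f_x bf control f_T).
exists (template_subspace D f c); split.
- exact: (template_subspace_closed gp bf).
- split=> [n n' _|a u v Mu Mv n n' own]; first by rewrite !linear0 !mul0r.
  by rewrite !linearP /= !mulrDl -!mulrA Mu // Mv.
- exact: (template_subspace_basis gp cp denseD f_x bf control c_rec).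
exact: (template_subspace_hypercyclic gp denseD f_x bf control f_T c_rec).
Qed.

(** * From seminorms to topology *)

Lemma biorthogonal_infinite_dimensional (K : numFieldType) (X : lmodType K) (M : set X)
    (b : nat -> X) (h : nat -> {scalar X}) :
  (forall i, M (b i)) -> (forall i j, h i (b j) = (i == j)%:R) ->
  ~ finite_dimensional M.
Proof.
move=> Mb hb [n [e [_ span_e]]].
have /choice[c cP] j := span_e (b j) (Mb j).
(* The identity matrix of size [n + 1] would factor through dimension [n]. *)
pose C := \matrix_(j < n.+1, i < n) c j i.
pose H := \matrix_(i < n, k < n.+1) h k (e i).
have CH : C *m H = 1%:M.
  apply/matrixP => j k; rewrite !mxE eq_sym -[_ == _]/(val k == val j) -hb cP linear_sum.
  by apply: eq_bigr => i _; rewrite !mxE linearZ.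
by have := mulmx_max_rank C H; rewrite CH mxrank1 ltnn.
Qed.

Section Bridge.
Variables (K : numFieldType) (X : topologicalLmodType K) (p : nat -> X -> K).
Hypothesis gp : graded_seminorms p.
Hypothesis nbhs0P : forall U : set X, nbhs 0 U <->
  exists n (e : K), 0 < e /\ [set x | p n x < e] `<=` U.

Lemma nbhs_seminormP (x : X) (U : set X) : nbhs x U <->
  exists n (e : K), 0 < e /\ forall y, p n (y - x) < e -> U y.
Proof.
split=> [xU|[n [e [e0 ballU]]]].
  have : nbhs (0 : X) [set z | U (z + x)].
    have /(_ U) := @tvs.add_continuous X (0, x); rewrite /= add0r => /(_ xU) H.
    have : (fun z : X => (z, x)) @ (0 : X) --> ((0 : X), x).
      by apply: cvg_pair; [exact: cvg_id | exact: cvg_cst].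
    by move=> /(_ _ H).
  move=> /nbhs0P[n [e [e0 ballU]]]; exists n, e; split=> // y lty.
  by have := ballU (y - x) lty; rewrite /= subrK.
have : nbhs (x - x) [set z | p n z < e] by rewrite subrr; apply/nbhs0P; exists n, e; split.
move=> /(@tvs.sub_continuous X (x, x)) H.
have : (fun z : X => (z, x)) @ x --> (x, x).
  by apply: cvg_pair; [exact: cvg_id | exact: cvg_cst].
move=> /(_ _ H) Hx; have {}Hx : nbhs x [set z | p n (z - x) < e] by exact: Hx.
by apply: filterS Hx => y; exact: ballU.
Qed.

Lemma nbhs_seminorm_ball (x : X) m (e : K) : 0 < e -> nbhs x [set y | p m (y - x) < e].
Proof. by move=> e0; apply/nbhs_seminormP; exists m, e. Qed.

Lemma dense_approximable (D : set X) : approximable p D -> dense D.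
Proof.
move=> apD O [x Ox] openO.
have /nbhs_seminormP[n [e [e0 ballO]]] : nbhs x O by exact: open_nbhs_nbhs.
by have [y Dy lty] := apD x n e e0; exists y; split=> //; exact: ballO.
Qed.

Lemma approximable_dense (D : set X) : dense D -> approximable p D.
Proof.
move=> denseD x m e e0.
have : nbhs x [set y | p m (y - x) < e] by exact: nbhs_seminorm_ball.
rewrite nbhsE => -[O [openO Ox] sO]; have [y [Oy Dy]] := denseD O (ex_intro _ x Ox) openO.
by exists y => //; exact: sO.
Qed.

Lemma separable_approximating : separable X -> exists d : nat -> X, approximating p d.
Proof.
move=> [D [/countable_injP[f injf] /approximable_dense apD]].
have /choice[d dP] n : exists x, forall y, D y -> f y = n -> x = y.
  have [[y [Dy <-]]|no] := pselect (exists y, D y /\ f y = n).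
    by exists y => z Dz /injf ->; rewrite ?inE.
  by exists 0 => y Dy fy; case: no; exists y.
have [c cP] := recurrent_enumeration 0%N.
exists (fun l => d (c l)) => x m e N e0; have [y Dy lty] := apD x m e e0.
by have [l leNl cl] := cP (f y) N; exists l; rewrite // cl (dP _ y).
Qed.

Lemma seq_complete_tvs : complete_tvs X -> seq_complete p.
Proof.
move=> cX u cauchy_u; have [U /nbhs0P[m [e [e0 ballU]]]|l ul] := cX u.
  have [N HN] := cauchy_u m e e0; exists N => i j lei lej; apply: ballU.
  exact: HN.
exists l => m e e0.
have /ul : nbhs l [set y | p m (y - l) < e] by exact: nbhs_seminorm_ball.
by case=> N _ HN; exists N => n; exact: HN.
Qed.

Lemma mixing_with_hypercyclic_subspace_tvs :
  mixing_with_hypercyclic_subspace p ->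
  exists T : {linear X -> X},
    [/\ continuous T, mixing T & exists M : set X, hypercyclic_subspace T M].
Proof.
move=> [T [bT mixT [M [closedM [M0 linM] [b [h [Mb hb]]] hcM]]]]; exists T; split.
- move=> x U /nbhs_seminormP[m [e [e0 ballU]]]; apply/nbhs_seminormP.
  have [m' [C [C0 bC]]] := bT m; have C1 : 0 < C + 1 by rewrite ltr_wpDl.
  exists m', (e / (C + 1)); split=> [|y]; first by rewrite divr_gt0.
  rewrite ltr_pdivlMr // => lty; apply: ballU; rewrite -linearB.
  apply: le_lt_trans (bC _) (le_lt_trans _ lty).
  by rewrite mulrC ler_wpM2l ?(sn_ge0 (gsn gp _)) // lerDl.
- move=> U V openU [u Uu] openV [v Vv].
  have /nbhs_seminormP[m1 [e1 [e10 ballU]]] : nbhs u U by exact: open_nbhs_nbhs.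
  have /nbhs_seminormP[m2 [e2 [e20 ballV]]] : nbhs v V by exact: open_nbhs_nbhs.
  have s0 : 0 < e1 + e2 by rewrite addr_gt0.
  have e0 : 0 < e1 * e2 / (e1 + e2) by rewrite divr_gt0 ?mulr_gt0.
  have [N HN] := mixT u v (maxn m1 m2) _ e0; exists N => n /HN[w [wu wv]].
  exists (iter n T w); split; first (exists w => //; apply: ballU); last apply: ballV.
    apply: le_lt_trans (gsn_mono gp _ (leq_maxl m1 m2)) (lt_trans wu _).
    by rewrite ltr_pdivrMr // ltr_pM2l // ltrDr.
  apply: le_lt_trans (gsn_mono gp _ (leq_maxr m1 m2)) (lt_trans wv _).
  by rewrite ltr_pdivrMr // mulrC ltr_pM2l // ltrDl.
exists M; split.
- move=> x clMx; apply: closedM => m e e0.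
  have /clMx[y [My lty]] : nbhs x [set y | p m (y - x) < e].
    exact: nbhs_seminorm_ball.
  by exists y.
- by split=> [|a u v]; rewrite !inE //; exact: linM.
- exact: (biorthogonal_infinite_dimensional Mb hb).
move=> x Mx x0; apply: dense_approximable => y m e e0.
have [z [n ->] ltz] := hcM x Mx x0 y m e e0.
by exists (iter n T x) => //; exists n.
Qed.

End Bridge.

Theorem theorem2p8 (R : realType) (K : numFieldType)
    (hK : real_or_complex R K) (X : topologicalLmodType K)
    (hX : is_frechet X) (sepX : separable X)
    (dimX : ~ finite_dimensional (@setT X)) :
  exists T : {linear X -> X},
    [/\ continuous T, mixing T & exists M : set X, hypercyclic_subspace T M].
Proof.
have [[p [sn_p mono_p sep_p nbhs0P]] complX] := hX.
have gp : graded_seminorms p by [].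
have archK := real_or_complex_archimedean hK.
have cp := seq_complete_tvs nbhs0P complX.
have [d dense_d] := separable_approximating nbhs0P sepX.
apply: (mixing_with_hypercyclic_subspace_tvs gp nbhs0P).
have [[a wide]|narrow] := pselect (exists a, forall n (f : nat -> {scalar X}),
    (forall i, bounded_form p (f i)) ->
    exists2 x, (forall i, (i < n)%N -> f i x = 0) & p a x != 0).
  exact: (wide_seminorm_case archK gp cp (real_or_complex_norming hK) dense_d wide).
apply: (narrow_seminorms_case gp cp dense_d dimX) => a; apply: contrapT => no.
apply: narrow; exists a => n f bf; apply: contrapT => no'; apply: no.
exists n, f; split=> // x fx; apply: contrapT => /eqP px; apply: no'.
by exists x.
Qed.
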